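(* Let $n\ge 2$ and let $M$ be a conformal manifold of dimension $n$ (where $M$ is a Hausdorff smooth manifold, not assumed paracompact or second countable). Then $M$ is paracompact.
   Context: An $n$-dimensional manifold is a Hausdorff topological space equipped with a maximal smooth atlas with values in $\mathbb{R}^n$; no paracompactness or second countability is assumed, and no connectedness is assumed. A conformal structure on a manifold $M$ is a reduction of the structure group of $TM$ from $GL(n,\mathbb{R})$ to $CO(n)=\mathbb{R}_+\times O(n)$; equivalently, it is given by a collection of Riemannian metrics defined on open subsets covering $M$ (local conformal metrics) which are conformal to each other on overlaps of their domains. A conformal manifold is a manifold equipped with a conformal structure. A topological space is paracompact if every open cover of it admits a locally finite open refinement. *)

(* Defs.v *)
From mathcomp Require Import all_boot all_order all_algebra.
From mathcomp Require Import all_classical all_reals all_analysis.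
Import Order.TTheory GRing.Theory Num.Theory.
Import numFieldNormedType.Exports.

Set Implicit Arguments.
Unset Strict Implicit.
Unset Printing Implicit Defensive.

Local Open Scope classical_set_scope.
Local Open Scope ring_scope.

Section Paracompact.
Variable T : topologicalType.
Implicit Types C D : set (set T).

Definition open_cover C := C `<=` open /\ \bigcup_(U in C) U = setT.

Definition refines D C := forall V, D V -> exists2 U, C U & V `<=` U.

Definition locally_finite D := forall x : T,
  exists2 W, nbhs x W & finite_set [set V | D V /\ V `&` W !=set0].

Definition paracompact := forall C, open_cover C ->
  exists D, [/\ open_cover D, refines D C & locally_finite D].

End Paracompact.

Section Smooth.
Variables (R : realType) (n : nat) (W : normedModType R).

(* All iterated partial derivatives of order at most k exist and are continuous
   on U. This is meant for open U; the values of f outside U play no role. *)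
Fixpoint Ck_on (k : nat) (U : set 'rV[R]_n) (f : 'rV[R]_n -> W) : Prop :=
  (forall x, U x -> {for x, continuous f}) /\
  if k is k'.+1 then
    forall i : 'I_n, (forall x, U x -> derivable f x (delta_mx 0 i)) /\
                     Ck_on k' U ('D_(delta_mx 0 i) f)
  else True.

Definition smooth_on (U : set 'rV[R]_n) (f : 'rV[R]_n -> W) :=
  forall k, Ck_on k U f.

End Smooth.

(* Charts are homeomorphisms between open sets, extended by arbitrary values
   outside these sets to total functions. *)
Record chart (R : realType) (n : nat) (M : topologicalType) := Chart {
  cdom : set M;
  crange : set 'rV[R]_n;
  cmap : M -> 'rV[R]_n;
  cinv : 'rV[R]_n -> M;
  cdom_open : open cdom;
  crange_open : open crange;
  cmap_sub : forall x, cdom x -> crange (cmap x);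
  cinv_sub : forall y, crange y -> cdom (cinv y);
  cmapK : forall x, cdom x -> cinv (cmap x) = x;
  cinvK : forall y, crange y -> cmap (cinv y) = y;
  cmap_continuous : {within cdom, continuous cmap};
  cinv_continuous : {within crange, continuous cinv} }.

Section Atlas.
Variables (R : realType) (n : nat) (M : topologicalType).
Implicit Types (c d : chart R n M) (A : set (chart R n M)).

Definition transition c d : 'rV[R]_n -> 'rV[R]_n := cmap d \o cinv c.

Definition compatible c d :=
  smooth_on (cmap c @` (cdom c `&` cdom d)) (transition c d) /\
  smooth_on (cmap d @` (cdom c `&` cdom d)) (transition d c).

Definition is_atlas A :=
  \bigcup_(c in A) cdom c = setT /\
  (forall c d, A c -> A d -> compatible c d).

Definition is_maximal_atlas A :=
  is_atlas A /\ (forall c, (forall d, A d -> compatible c d) -> A c).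

End Atlas.

Record manifold (R : realType) (n : nat) := Manifold {
  carrier :> topologicalType;
  carrier_hausdorff : hausdorff_space carrier;
  atlas : set (chart R n carrier);
  atlas_maximal : is_maximal_atlas atlas }.

Section Conformal.
Variables (R : realType) (n : nat) (M : manifold R n).

Definition smooth_fun (V : set M) (f : M -> R) := forall c, atlas c ->
  smooth_on (cmap c @` (cdom c `&` V)) (f \o cinv c : 'rV[R]_n -> R).

(* A Riemannian metric on the open set gdom, as a symmetric 2-tensor: gmx c x is
   its Gram matrix at x in the coordinates of the chart c. Tangent vectors are
   row vectors, so a vector with coordinates v in the chart c has coordinates
   v *m 'J (transition c d) (cmap c x) in the chart d. *)
Record local_metric := LocalMetric {
  gdom : set M;
  gmx : chart R n M -> M -> 'M[R]_n;
  gdom_open : open gdom;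
  gmx_sym : forall c x, atlas c -> cdom c x -> gdom x ->
    (gmx c x)^T = gmx c x;
  gmx_pos : forall c x, atlas c -> cdom c x -> gdom x ->
    forall v : 'rV[R]_n, v != 0 -> 0 < (v *m gmx c x *m v^T) 0 0;
  gmx_smooth : forall c, atlas c ->
    smooth_on (cmap c @` (cdom c `&` gdom)) (gmx c \o cinv c);
  gmx_change : forall c d x, atlas c -> atlas d ->
    cdom c x -> cdom d x -> gdom x ->
    gmx c x = 'J (transition c d) (cmap c x) *m gmx d x
              *m ('J (transition c d) (cmap c x))^T }.

Definition conformal (g h : local_metric) :=
  exists f : M -> R,
    [/\ smooth_fun (gdom g `&` gdom h) f,
        forall x, gdom g x -> gdom h x -> 0 < f x &
        forall c x, atlas c -> cdom c x -> gdom g x -> gdom h x ->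
          gmx h c x = f x *: gmx g c x].

Record conformal_structure := ConformalStructure {
  metrics : set local_metric;
  metrics_cover : \bigcup_(g in metrics) gdom g = setT;
  metrics_conformal : forall g h, metrics g -> metrics h -> conformal g h }.

End Conformal.

Record conformal_manifold (R : realType) (n : nat) := ConformalManifold {
  underlying :> manifold R n;
  structure : conformal_structure underlying }.

(* Main.v *)
Require Import Defs.
From mathcomp Require Import all_boot all_order all_algebra.
From mathcomp Require Import all_classical all_reals all_analysis.
From mathcomp Require Import ring lra zify.
From mathcomp Require Import wochoice.
Import Order.TTheory GRing.Theory Num.Theory.
Import numFieldNormedType.Exports.

Set Implicit Arguments.
Unset Strict Implicit.
Unset Printing Implicit Defensive.

Local Open Scope classical_set_scope.
Local Open Scope ring_scope.

(** Two points of [M] are declared [e]-near ([conf_near]) when a connected set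
    containing both carries a function [u >= 1] of conformal [n]-energy at most
    [e]. These relations form a uniformity with a countable base for the
    topology of [M], and a space with such a uniformity is paracompact
    ([uniform_paracompact], Stone's theorem with M. E. Rudin's proof).

    The [n]-energy of [u] is the integral of the [n]-th power of its gradient,
    the only exponent for which the integral depends on the metric through its
    conformal class alone; it therefore makes sense on [M] without a global
    metric. Here it is replaced by the sums of [`|u y - u y'| ^+ n] over finite
    packings by small disjoint chart cubes, with [y] and [y'] near one cube of
    the packing, the sums being bounded by [A ^+ n * e] when [A] bounds the
    eccentricity of the metric in the chart ([energy_le]). A conformal change of
    the metric leaves the eccentricity alone. How small the cubes have to be is
    prescribed by a gauge, which may depend on [u]; the sums thus stand for the
    integral although [u] is an arbitrary function.

    Three facts make the relations a uniformity.

    - Triangle inequality: unite the connected sets and take the maximum of the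
      two functions; energies add up ([energy_le_max]).

    - Each [e]-ball is a neighbourhood of its centre, because points have zero
      [n]-capacity when [n >= 2] ([small_capacity]): the average of [L] ramps
      supported in disjoint geometric shells has energy of order [L ^ (1 - n)].
      Comparing the chart of the bump with the other charts uses the strict
      differentiability of transition maps ([packing_cell]) and the volume of
      disjoint cubes ([disjoint_cubes_volume]).

    - Small balls are small. Hyperplanes have dimension [n - 1 < n], so Morrey's
      inequality, in a discrete form ([morrey], [morrey_slices]), shows that a
      function of small energy is almost constant on all coordinate slices of a
      chart cube but a few ([local_slices]). A connected set that leaves a small
      cube crosses one of the good slices, which form the faces of a slightly
      larger cube, and two slices in different directions meet since [n >= 2].
      Hence, if [u] is small on one slice of a chart cube, it is small somewhere
      on every connected set that starts near a given point of this cube and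
      is not too small ([control_near]); this in turn gives a slice on which
      [u] is small in any overlapping cube ([controlled_slice]). The property
      [controlled], that [u] cannot be large on a big continuum near a point,
      thus spreads from one point to its whole connected component
      ([controlled_component]); the bounds depend on the cubes that were
      crossed, but not on [u].

    For the propagation to start, [u] must vanish somewhere near a base point of
    the component. The normalisation has to survive maxima, and to be satisfied
    by bumps around the base point itself: the support of [u] is required to
    meet only a set of measure at most [e] of the parallel hyperplanes of a
    fixed cube around the base point ([few_sheets]). *)

(** * Paracompactness from a countably based uniformity *)

Lemma pow2_small (R : realType) (e : R) : 0 < e -> exists i : nat, (2 ^+ i)^-1 < e.
Proof.
move=> e0; have [N _ /(_ N)/(_ (leqnn _))] := near_infty_natSinv_expn_lt (PosNum e0).
by rewrite div1r => hN; exists N.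
Qed.

Lemma finite_subset1 (T : Type) (A : set T) :
  (forall x y, A x -> A y -> x = y) -> finite_set A.
Proof.
move=> A1; have [->|/set0P[x Ax]] := eqVneq A set0; first exact: finite_set0.
by apply: (sub_finite_set _ (finite_set1 x)) => y Ay; exact: A1.
Qed.

(** [near_rel e x] is the [e]-ball around [x] of a uniformity. Rudin's proof of
    Stone's theorem uses balls and their composition alone, so that it carries
    over from metric spaces. *)
Section Stone.
Variables (R : realType) (T : topologicalType) (near_rel : R -> T -> T -> Prop).

Hypothesis near_sym : forall e x y, near_rel e x y -> near_rel e y x.
Hypothesis near_mono : forall e f x y, e <= f -> near_rel e x y -> near_rel f x y.
Hypothesis near_trans : forall e f x y z,
  near_rel e x y -> near_rel f y z -> near_rel (e + f) x z.
Hypothesis near_nbhs : forall e x, 0 < e -> nbhs x (near_rel e x).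
Hypothesis near_small : forall x U, nbhs x U ->
  exists2 e, 0 < e & near_rel e x `<=` U.

Let rad (i : nat) : R := (2 ^+ i)^-1.

Let rad_gt0 i : 0 < rad i. Proof. by rewrite invr_gt0 exprn_gt0. Qed.

Let radS i : rad i = rad i.+1 + rad i.+1.
Proof. by rewrite /rad exprS invfM; lra. Qed.

Let rad_le i j : (i <= j)%N -> rad j <= rad i.
Proof. by move=> ij; rewrite /rad lef_pV2 ?posrE ?exprn_gt0// ler_weXn2l// ler1n. Qed.

Section Cover.
Variables (C : set (set T)) (r : rel (set T)).
Hypotheses (C_open : forall V, C V -> open V) (C_cover : forall x, exists2 V, C V & V x).
Hypothesis r_wo : well_order r.

Definition first_set V x := [/\ C V, V x & forall V', C V' -> V' x -> r V V'].

Lemma first_setP x : exists V, first_set V x.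
Proof.
have [V CV Vx] := C_cover x.
have [|W [[WA lW] _]] := r_wo (A := [pred V' | `[< C V' /\ V' x >]]).
  by exists V; apply/asboolP.
move: WA => /asboolP[CW Wx]; exists W; split => // V' CV' V'x.
by apply: lW; apply/asboolP.
Qed.

Lemma wo_total V W : r V W || r W V.
Proof.
have := @wo_chainW _ r predT.
by apply=> //; apply: withinW => A; exact: r_wo.
Qed.

Lemma wo_anti V W : r V W -> r W V -> V = W.
Proof.
move=> VW WV; have := @wo_chain_antisymmetric _ r predT.
by move=> /(_ _ V W isT isT); apply; [apply: withinW => A; exact: r_wo|rewrite VW].
Qed.

(** The part of [V] treated at stage [j]: balls around the points that belong
    first to [V], lie deep inside [V] at scale [rad j], and were not covered by
    the earlier stages [W]. *)
Definition layer (W : set T) (j : nat) (V : set T) : set T :=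
  \bigcup_(y in [set y | [/\ first_set V y, ~ W y & near_rel (3 * rad j) y `<=` V]])
    (near_rel (rad j) y)°.

Fixpoint used j : set T :=
  if j is i.+1 then used i `|` \bigcup_(V in C) layer (used i) i V else set0.

Lemma layer_open W j V : open (layer W j V).
Proof. by apply: bigcup_open => y _; exact: open_interior. Qed.

Lemma usedP j x : used j x <-> exists i V, [/\ (i < j)%N, C V & layer (used i) i V x].
Proof.
elim: j => [|j IH] /=; first by split => // -[i [V []]].
split=> [[/IH[i [V [ij CV h]]]|[V CV h]]|[i [V []]]].
- by exists i, V; split => //; exact: ltnW.
- by exists j, V; split.
- rewrite ltnS leq_eqVlt => /orP[/eqP->|ij] CV h; first by right; exists V.
  by left; apply/IH; exists i, V.
Qed.

Lemma interior_near e x : 0 < e -> (near_rel e x)° x.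
Proof. exact: near_nbhs. Qed.

Lemma layer_cover x : exists j V, C V /\ layer (used j) j V x.
Proof.
have [V fV] := first_setP x; have [CV Vx _] := fV.
have [e e0 eV] := near_small (open_nbhs_nbhs (conj (C_open CV) Vx)).
have [j je] := @pow2_small R (e / 3) ltac:(by rewrite divr_gt0).
have sV : near_rel (3 * rad j) x `<=` V.
  move=> y h; apply: eV; apply: near_mono h.
  by move: je; rewrite -/(rad j); lra.
have [/usedP[i [W [_ CW h]]]|nu] := pselect (used j x); first by exists i, W.
by exists j, V; split => //; exists x; [split|apply: interior_near; exact: rad_gt0].
Qed.

Lemma layer_sub W j V : layer W j V `<=` V.
Proof.
move=> x [y [_ _ sV] /interior_subset h]; apply: sV; apply: near_mono h.
by have := rad_gt0 j; lra.
Qed.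

(** A small ball that met both layers would connect a point [b] deep inside [V]
    to a point [d] that belongs first to [V'], with [V] before [V']; then [d]
    would lie in [V], hence come first there. *)
Lemma layer_uniq W j V V' x z : 0 < x -> x + x <= rad j ->
  layer W j V `&` near_rel x z !=set0 ->
  layer W j V' `&` near_rel x z !=set0 -> V = V'.
Proof.
move=> x0 xj.
wlog rVV' : V V' / r V V'.
  move=> wl h h'; have /orP[rr|rr] := wo_total V V'; first exact: (wl V V').
  exact/esym/(wl V' V).
move=> [a [[b [fb nb sb] /interior_subset hb] ha]].
move=> [c [[d [fd nd sd] /interior_subset hd] hc]].
have bd : near_rel (3 * rad j) b d.
  have h1 := near_trans (near_trans hb (near_sym ha)) (near_trans hc (near_sym hd)).
  by apply: near_mono h1; lra.
apply: wo_anti => //.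
case: fd => CV' V'd minV'; case: fb => CV _ _; exact: minV' (sb _ bd).
Qed.

(** A point [x] is covered at some stage [j], with room [rad k]. Layers of a
    later stage than [j + k] are built from balls too small to reach the middle
    of that room from outside; each earlier stage contributes one layer at most,
    by [layer_uniq]. *)
Lemma layers_locally_finite :
  locally_finite [set D | exists j V, C V /\ D = layer (used j) j V].
Proof.
move=> x; have [j [V [CV Vx]]] := layer_cover x.
have [e e0 eV] := near_small (open_nbhs_nbhs (conj (layer_open (used j) j V) Vx)).
have [k ke] := pow2_small e0.
pose N := (j + k).+1; pose eps := rad N.
exists (near_rel eps x); first by apply: near_nbhs; exact: rad_gt0.
apply: (@sub_finite_set _ _ (\bigcup_(i in `I_N) [set D | (exists2 V', C V' &
    D = layer (used i) i V') /\ D `&` near_rel eps x !=set0])); last first.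
  apply: bigcup_finite; first exact: finite_II.
  move=> i /= iN; apply: finite_subset1 => _ _ [[V1 CV1 ->] h1] [[V2 CV2 ->] h2].
  congr layer; apply: (layer_uniq (rad_gt0 N) _ h1 h2).
  by rewrite -/eps /eps -radS; apply: rad_le.
move=> _ [[i [V' [CV' ->]]] h]; exists i; last by split => //; exists V'.
rewrite /= ltnNge; apply/negP => Ni.
case: h => a [[b [_ nb _] /interior_subset hb] ha].
apply: nb; apply/usedP; exists j, V; split => //; first by rewrite /N in Ni; lia.
apply: eV; apply: near_mono (near_trans ha (near_sym hb)).
apply: le_trans (ltW ke); rewrite -/(rad k).
have h1 : rad i <= eps by exact: rad_le.
have h2 : rad (j + k) <= rad k by apply: rad_le; rewrite leq_addl.
by have := radS (j + k); rewrite -/N -/eps; lra.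
Qed.

End Cover.

Lemma uniform_paracompact : paracompact T.
Proof.
move=> C [Cop Ccov].
have [r r_wo] := well_ordering_principle (set T).
have cov x : exists2 V, C V & V x.
  by have : [set: T] x by []; rewrite -Ccov => -[V]; exists V.
exists [set D | exists j V, C V /\ D = layer C r (used C r j) j V]; split.
- split; first by move=> _ [j [V [_ ->]]]; exact: layer_open.
  apply/seteqP; split => // x _.
  have [j [V [CV h]]] := layer_cover Cop cov r_wo x.
  by exists (layer C r (used C r j) j V) => //; exists j, V.
- by move=> _ [j [V [CV ->]]]; exists V => //; exact: layer_sub.
- exact: layers_locally_finite Cop cov r_wo.
Qed.
End Stone.

(** * Power means and roots *)

Section PowerMean.
Variable R : realType.
Implicit Types x c : R.

(** A power lies above its tangent at [c]. Summed over the data with [c] their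
    mean, this is the power mean inequality. *)
Lemma tangent_expr (n : nat) x c : 0 <= x -> 0 <= c ->
  n.+1%:R * c ^+ n * x <= x ^+ n.+1 + n%:R * c ^+ n.+1.
Proof.
move=> x0 c0; elim: n => [|n IH]; first by rewrite !expr0 !expr1; lra.
rewrite -subr_ge0.
have -> : x ^+ n.+2 + n.+1%:R * c ^+ n.+2 - n.+2%:R * c ^+ n.+1 * x =
  x * (x ^+ n.+1 + n%:R * c ^+ n.+1 - n.+1%:R * c ^+ n * x) +
  n.+1%:R * c ^+ n * (x - c) ^+ 2.
  by rewrite -!natr1 !exprS; ring.
apply: addr_ge0; apply: mulr_ge0 => //; rewrite ?subr_ge0 ?sqr_ge0//.
by rewrite mulr_ge0 ?ler0n ?exprn_ge0.
Qed.

Lemma power_mean (I : finType) (A : pred I) (f : I -> R) (n : nat) : (0 < n)%N ->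
  (forall i, A i -> 0 <= f i) ->
  (\sum_(i | A i) f i) ^+ n <= #|A|%:R ^+ n.-1 * \sum_(i | A i) f i ^+ n.
Proof.
case: n => // n _ f0; set S := \sum_(i | A i) f i; set m : R := #|A|%:R.
have [A0|A0] := eqVneq #|A| 0%N.
  have -> : S = 0.
    by rewrite /S big_pred0// => i; move/card0_eq: A0 => /(_ i); rewrite inE.
  by rewrite expr0n/= mulr_ge0// ?exprn_ge0 ?ler0n// sumr_ge0// => i Ai; rewrite exprn_ge0// f0.
have m0 : 0 < m by rewrite ltr0n lt0n.
have S0 : 0 <= S by apply: sumr_ge0.
pose c := S / m; have c0 : 0 <= c by rewrite divr_ge0// ltW.
have Sc : S = m * c by rewrite /c mulrC divfK// gt_eqF.
have h : m * c ^+ n.+1 <= \sum_(i | A i) f i ^+ n.+1.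
  have : \sum_(i | A i) (n.+1%:R * c ^+ n * f i) <=
         \sum_(i | A i) (f i ^+ n.+1 + n%:R * c ^+ n.+1).
    by apply: ler_sum => i Ai; apply: tangent_expr => //; exact: f0.
  rewrite -mulr_sumr big_split/= sumr_const -/S -mulr_natl -/m Sc -natr1 exprS.
  by nra.
rewrite Sc exprMn exprSr -mulrA ler_wpM2l// exprn_ge0// ltW//.
Qed.
End PowerMean.

Section Root.
Variables (R : realType) (n : nat).
Hypothesis n0 : (0 < n)%N.
Definition nth_root (a : R) := a `^ (n%:R^-1).
Lemma nth_root_ge0 a : 0 <= nth_root a. Proof. exact: powR_ge0. Qed.
Lemma nth_root_expr a : 0 <= a -> nth_root a ^+ n = a.
Proof.
move=> a0; rewrite /nth_root -powR_mulrn ?powR_ge0// -powRrM mulVf ?pnatr_eq0 -?lt0n//.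
by rewrite powRr1.
Qed.
Lemma le_root a b : 0 <= b -> 0 <= a -> b ^+ n <= a -> b <= nth_root a.
Proof.
by move=> b0 a0 h; rewrite -(@ler_pXn2r _ n)// ?nnegrE ?nth_root_ge0// nth_root_expr.
Qed.
End Root.

(** * Discrete Morrey inequality on dyadic grids *)

Section Grid.
Variables (R : realType) (n k : nat).
Local Notation pt := {ffun 'I_n -> 'I_(2 ^ k)}.
Implicit Types (a x y : pt) (j : nat) (J : {set 'I_n}) (i : 'I_n) (s t : 'I_(2 ^ k)).

Definition same_block j s t := (s %/ 2 ^ j == t %/ 2 ^ j)%N.

Lemma same_block_refl j s : same_block j s s. Proof. exact: eqxx. Qed.

Lemma same_blockS j s t : same_block j s t -> same_block j.+1 s t.
Proof. by rewrite /same_block expnSr !divnMA => /eqP->. Qed.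

Lemma same_block_top s t : same_block k s t.
Proof. by rewrite /same_block !divn_small. Qed.

Definition block j s : {set 'I_(2 ^ k)} := finset (fun t => same_block j t s).

Lemma mem_block j s t : (t \in block j s) = same_block j t s.
Proof. exact: finset.in_set. Qed.

Lemma card_block j s : (j <= k)%N -> (2 ^ j <= #|block j s|)%N.
Proof.
move=> jk.
have lt (r : 'I_(2 ^ j)) : ((s %/ 2 ^ j) * 2 ^ j + r < 2 ^ k)%N.
  have : (s %/ 2 ^ j < 2 ^ (k - j))%N.
    by rewrite ltn_divLR ?expn_gt0// -expnD subnK.
  move=> h; apply: (@leq_trans ((s %/ 2 ^ j).+1 * 2 ^ j)).
    by rewrite mulSn addnC ltn_add2r.
  have E : (2 ^ k = 2 ^ (k - j) * 2 ^ j)%N by rewrite -expnD subnK.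
  by rewrite [leqRHS]E leq_mul2r h orbT.
pose f (r : 'I_(2 ^ j)) : 'I_(2 ^ k) := Ordinal (lt r).
have finj : injective f.
  by move=> r r' /(congr1 val)/= /addnI h; apply: val_inj.
rewrite -[X in (X <= _)%N]card_ord -cardsT -(card_imset _ finj).
apply/subset_leq_card/fintype.subsetP => _ /imsetP[r _ ->].
by rewrite mem_block /same_block /= divnMDl ?expn_gt0// (divn_small (ltn_ord r)) addn0.
Qed.

Definition upd x i t : pt := [ffun l => if l == i then t else x l].

Lemma updE x i t l : upd x i t l = if l == i then t else x l.
Proof. by rewrite ffunE. Qed.

Lemma upd_id x i : upd x i (x i) = x.
Proof. by apply/ffunP => l; rewrite updE; case: eqP => // ->. Qed.

Lemma updC x i l s t : i != l -> upd (upd x i s) l t = upd (upd x l t) i s.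
Proof.
move=> il; apply/ffunP => m; rewrite !updE.
by have [->|] := eqVneq m l; rewrite // eq_sym (negbTE il).
Qed.

(** The dyadic box of side [2 ^ j] around [a], of dimension [#|J|]: coordinates
    outside [J] are frozen. *)
Definition inbox a j J x : bool :=
  [forall i, if i \in J then same_block j (x i) (a i) else x i == a i].

Lemma inboxP a j J x : reflect
  (forall i, if i \in J then same_block j (x i) (a i) else x i == a i) (inbox a j J x).
Proof. exact: forallP. Qed.

Lemma inbox_refl a j J : inbox a j J a.
Proof. by apply/inboxP => i; case: ifP => _; rewrite ?same_block_refl. Qed.

Lemma inbox_eq a j J x : inbox a j J x -> inbox x j J = inbox a j J.
Proof.
move=> /inboxP h; apply/funext => y; apply/inboxP/inboxP => h' i; have := h i; have := h' i;
  by case: ifP => _; rewrite /same_block => /eqP-> /eqP->.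
Qed.

Lemma inbox_slice a j J i t x : i \in J -> same_block j t (a i) ->
  inbox a j J x && (x i == t) = inbox (upd a i t) j (J :\ i) x.
Proof.
move=> iJ ta; apply/andP/inboxP => [[/inboxP h /eqP xt] l|h].
  rewrite !inE updE; have [->/=|li /=] := eqVneq l i; first by rewrite xt.
  exact: h.
have xt : x i = t by have := h i; rewrite !inE eqxx/= updE eqxx => /eqP.
split; last exact/eqP; apply/inboxP => l; have := h l; rewrite !inE updE.
by have [->/=|//] := eqVneq l i; rewrite iJ xt.
Qed.

Variables (F G : pt -> R).
Hypothesis G0 : forall x, 0 <= G x.

Definition box_energy a j J := \sum_(x | inbox a j J x) G x.

Lemma box_energy_ge0 a j J : 0 <= box_energy a j J.
Proof. exact: sumr_ge0. Qed.

Lemma box_energyS a j J : box_energy a j J <= box_energy a j.+1 J.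
Proof.
rewrite /box_energy [leRHS](bigID (inbox a j J))/= -[leLHS]addr0 lerD ?sumr_ge0//.
rewrite le_eqVlt; apply/orP; left; apply/eqP/eq_bigl => x.
have [/inboxP h|] := boolP (inbox a j J x); last by rewrite andbF.
rewrite andbT; apply/esym/inboxP => i; have := h i; case: ifP => // _.
exact: same_blockS.
Qed.

Lemma sum_slices a j J i (S : {set 'I_(2 ^ k)}) : i \in J ->
  (forall t, t \in S -> same_block j t (a i)) ->
  \sum_(t in S) box_energy (upd a i t) j (J :\ i) <= box_energy a j J.
Proof.
move=> iJ hS; rewrite /box_energy [leRHS](partition_big (fun x => x i) predT)//=.
rewrite [leRHS](bigID (mem S))/= -[leLHS]addr0 lerD//; last first.
  by apply: sumr_ge0 => t _; apply: sumr_ge0.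
apply: ler_sum => t tS; rewrite le_eqVlt; apply/orP; left; apply/eqP/eq_bigl => x.
by rewrite -inbox_slice//; exact: hS.
Qed.

Definition good_slice a j J i t :=
  2 ^+ j * box_energy (upd a i t) j (J :\ i) <= 4 * box_energy a j J.

(** Averaging: the slices in [S] share the energy of the box, so one of them is
    at most [4 / 2 ^ j] of it if [S] has at least a quarter of [2 ^ j] elements.
    A constant above one leaves room for slices confined to half of the box. *)
Lemma good_slice_exists a j J i (S : {set 'I_(2 ^ k)}) : i \in J ->
  (forall t, t \in S -> same_block j t (a i)) -> (2 ^ j <= 4 * #|S|)%N ->
  exists2 t, t \in S & good_slice a j J i t.
Proof.
move=> iJ hS cS; apply: contrapT => nex.
have h t : t \in S -> 4 * box_energy a j J < 2 ^+ j * box_energy (upd a i t) j (J :\ i).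
  move=> tS; rewrite ltNge; apply/negP => gt; apply: nex; exists t => //.
have S0 : (0 < #|S|)%N by have := expn_gt0 2 j; lia.
have [t0 t0S] : exists t, t \in S by apply/set0Pn; rewrite -card_gt0.
have : \sum_(t in S) 4 * box_energy a j J <
       \sum_(t in S) 2 ^+ j * box_energy (upd a i t) j (J :\ i).
  by apply: ltr_sum => //; apply/hasP; exists t0; rewrite ?mem_index_enum.
rewrite sumr_const -mulr_sumr; apply/negP; rewrite -leNgt.
have h1 := sum_slices iJ hS.
apply: (@le_trans _ _ (2 ^+ j * box_energy a j J)); first by rewrite ler_wpM2l// exprn_ge0.
rewrite -mulrnAl -natrX ler_wpM2r ?box_energy_ge0//.
by rewrite -[leRHS]mulr_natr -natrM ler_nat.
Qed.

End Grid.

Section Morrey.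
Variables (R : realType) (n : nat).
Local Notation pt k := {ffun 'I_n -> 'I_(2 ^ k)}.

(** [G] plays the [n]-th power of the gradient of [F]. *)
Definition grid_bound k (F G : pt k -> R) :=
  (forall x, 0 <= G x) /\
  forall (x : pt k) i (t : 'I_(2 ^ k)), t = (x i).+1 :> nat ->
    `|F (upd x i t) - F x| ^+ n <= G x.

(** Morrey's inequality in dimension [d]: the exponent [n - d] of the side is
    positive for [d < n], which is what makes small boxes carry small
    oscillation. *)
Definition morrey_dim d := exists2 K : R, 0 <= K & forall k F G, @grid_bound k F G ->
  forall (J : {set 'I_n}) j a x y, #|J| = d -> (j <= k)%N ->
  inbox a j J x -> inbox a j J y ->
  `|F x - F y| ^+ n <= K * (2 ^+ j) ^+ (n - d) * box_energy G a j J.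

Lemma chain_bound k (f : 'I_(2 ^ k) -> R) (g : 'I_(2 ^ k) -> R) (s t : 'I_(2 ^ k)) :
  (forall r r' : 'I_(2 ^ k), r' = r.+1 :> nat -> `|f r' - f r| <= g r) ->
  (s <= t)%N -> `|f t - f s| <= \sum_(r : 'I_(2 ^ k) | (s <= r < t)%N) g r.
Proof.
move=> fg; move: {2}(t - s)%N (erefl (t - s)%N) => m; elim: m t => [|m IH] t E st.
  have -> : t = s by apply/val_inj => /=; lia.
  by rewrite subrr normr0 big_pred0// => r; lia.
have t'lt : (t.-1 < 2 ^ k)%N by apply: leq_ltn_trans (ltn_ord t); rewrite leq_pred.
pose t' := Ordinal t'lt; have tt' : t = t'.+1 :> nat by rewrite /=; lia.
rewrite (bigD1 t')/=; last by lia.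
have -> : f t - f s = (f t - f t') + (f t' - f s) by ring.
apply: (le_trans (ler_normD _ _)); apply: lerD; first exact: fg.
apply: (le_trans (IH t' _ _)); [rewrite /=; lia|rewrite /=; lia|].
rewrite le_eqVlt; apply/orP; left; apply/eqP/eq_bigl => r.
rewrite -val_eqE /=; lia.
Qed.

Lemma card_block_le k j (s : 'I_(2 ^ k)) : (#|block j s| <= 2 ^ j)%N.
Proof.
have lt0 : (0 < 2 ^ j)%N by rewrite expn_gt0.
pose f (r : 'I_(2 ^ k)) : 'I_(2 ^ j) := Ordinal (ltn_pmod r lt0).
have finj : {in block j s &, injective f}.
  move=> r r'; rewrite !mem_block /same_block => /eqP h /eqP h' /(congr1 val)/= e.
  by apply: val_inj; rewrite /= (divn_eq r (2 ^ j)) h e -h' -divn_eq.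
by rewrite -[leqRHS]card_ord -(card_in_imset finj) max_card.
Qed.

Lemma box_energy_mem k G a j (J : {set 'I_n}) x : (forall x, 0 <= G x) ->
  inbox a j J x -> G x <= @box_energy R n k G a j J.
Proof.
by move=> G0 ax; rewrite /box_energy (bigD1 x)//= lerDl sumr_ge0.
Qed.

Lemma morrey1 : (1 < n)%N -> morrey_dim 1.
Proof.
move=> n1; exists 1 => // k F G [G0 FG] J j a x y /eqP/cards1P[i ->] jk.
wlog xy : x y / (x i <= y i)%N.
  move=> wl ax ay; have [|/ltnW] := leqP (x i) (y i); first by move=> h; apply: wl.
  by rewrite distrC => h; apply: wl.
move=> /inboxP ax /inboxP ay.
have n0 : (0 < n)%N by exact: ltnW.
have Ex (z : pt k) :
    (forall l, if l \in [set i]%SET then same_block j (z l) (a l) else z l == a l) ->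
    z = upd a i (z i).
  move=> h; apply/ffunP => l; rewrite updE; case: eqP => [->//|/eqP li].
  by have := h l; rewrite inE (negbTE li) => /eqP.
have bx : same_block j (x i) (a i) by have := ax i; rewrite !inE eqxx.
have by_ : same_block j (y i) (a i) by have := ay i; rewrite !inE eqxx.
have hs : forall r : 'I_(2 ^ k), (x i <= r < y i)%N -> same_block j r (a i).
  move=> r /andP[h1 h2]; rewrite /same_block eqn_leq -{1}(eqP by_) -(eqP bx).
  by rewrite !leq_div2r// ltnW.
have := @chain_bound k (fun r => F (upd a i r)) (fun r => nth_root n (G (upd a i r)))
   (x i) (y i) _ xy.
rewrite -!Ex// => /(_ _)/wrap[].
  move=> r r' rr'; apply: le_root => //.
  have := FG (upd a i r) i r'; rewrite updE eqxx => /(_ rr').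
  suff -> : upd (upd a i r) i r' = upd a i r' by [].
  by apply/ffunP => l; rewrite !updE; case: eqP.
move=> h; rewrite distrC.
have : `|F y - F x| ^+ n <=
    (\sum_(r : 'I_(2 ^ k) | (x i <= r < y i)%N) nth_root n (G (upd a i r))) ^+ n.
  by rewrite lerXn2r// nnegrE// sumr_ge0// => r _; exact: nth_root_ge0.
move=> /le_trans; apply.
apply: (le_trans (power_mean n0 _)).
  by move=> r _; exact: nth_root_ge0.
rewrite mul1r -subn1; apply: ler_pM.
- by rewrite exprn_ge0.
- by apply: sumr_ge0 => r _; rewrite exprn_ge0// nth_root_ge0.
- rewrite lerXn2r ?nnegrE ?exprn_ge0// -natrX ler_nat.
  apply: leq_trans (card_block_le j (a i)); apply/subset_leq_card/fintype.subsetP => r.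
  by move=> hr; rewrite mem_block; exact: hs hr.
have h1 := @sum_slices R n k G G0 a j [set i]%SET i (block j (a i)).
apply: le_trans (h1 _ _); rewrite ?inE//; last by move=> t; rewrite mem_block.
rewrite [leRHS](bigID (fun r : 'I_(2 ^ k) => (x i <= r < y i)%N))/= -[leLHS]addr0.
apply: lerD; last by apply: sumr_ge0 => t _; exact: box_energy_ge0.
rewrite [leRHS](eq_bigl (fun r : 'I_(2 ^ k) => (x i <= r < y i)%N)); last first.
  by move=> r; rewrite mem_block andb_idl// => /hs.
apply: ler_sum => r hr; rewrite nth_root_expr//.
by apply: box_energy_mem => //; exact: inbox_refl.
Qed.

Lemma inbox_upd k (a x : pt k) j (J : {set 'I_n}) i t :
  inbox a j J x -> i \in J -> same_block j t (a i) -> inbox a j J (upd x i t).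
Proof.
move=> /inboxP ax iJ ta; apply/inboxP => l; rewrite updE.
by have [->|_] := eqVneq l i; [rewrite iJ|exact: ax].
Qed.

Lemma box_energy_eq k G (a x : pt k) j (J : {set 'I_n}) :
  inbox a j J x -> @box_energy R n k G x j J = box_energy G a j J.
Proof. by move=> ax; rewrite /box_energy (inbox_eq ax). Qed.

Lemma dist_chain4 (x0 x1 x2 x3 x4 a1 a2 a3 a4 : R) : `|x0 - x1| <= a1 ->
  `|x1 - x2| <= a2 -> `|x2 - x3| <= a3 -> `|x3 - x4| <= a4 ->
  `|x0 - x4| <= a1 + a2 + a3 + a4.
Proof.
move=> h1 h2 h3 h4; apply: (le_trans (ler_distD x3 _ _)); apply: lerD => //.
apply: (le_trans (ler_distD x2 _ _)); apply: lerD => //.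
by apply: (le_trans (ler_distD x1 _ _)); apply: lerD.
Qed.

Lemma step_arith (B r e e' : R) : 0 <= B -> r <= 1 -> 0 <= e' -> e <= r * e' ->
  B = B * r + 3 -> B * e + e + e' + e' <= B * e'.
Proof.
move=> B0 r1 e0 er Br.
have h1 : B * e <= B * (r * e') by rewrite ler_wpM2l.
have h2 : r * e' <= e' by rewrite ler_piMl.
have h3 : B * e' = B * (r * e') + 3 * e' by rewrite mulrA -mulrDl -Br.
lra.
Qed.

(** From dimension [d] to [d + 1]. In a box of dimension [d + 1] most slices
    have controlled oscillation by induction. A point is joined to a good slice
    of its box by going through smaller and smaller boxes around it, and good
    slices in two different directions intersect. *)
Section MorreyStep.
Variables (d : nat) (K : R) (k : nat) (F G : pt k -> R).
Hypotheses (dn : (d.+1 < n)%N) (K0 : 0 <= K) (FG : grid_bound F G).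
Hypothesis IH : forall (J : {set 'I_n}) j a x y, #|J| = d -> (j <= k)%N ->
  inbox a j J x -> inbox a j J y ->
  `|F x - F y| ^+ n <= K * (2 ^+ j) ^+ (n - d) * box_energy G a j J.
Variables (J : {set 'I_n}) (cJ : #|J| = d.+1).

Let n0 : (0 < n)%N. Proof. by lia. Qed.
Let G0 : forall x, 0 <= G x. Proof. by case: FG. Qed.

(* [D j a] is the oscillation that the induction hypothesis allows on a good
   slice of the box of side [2 ^ j] around [a]. *)
Let scaled j a := (2 ^+ j) ^+ (n - d.+1) * box_energy G a j J.
Let D j a := nth_root n (4 * K * scaled j a).

Let scaled_ge0 j a : 0 <= scaled j a.
Proof. by rewrite mulr_ge0 ?exprn_ge0 ?box_energy_ge0. Qed.

Let D_arg_ge0 j a : 0 <= 4 * K * scaled j a.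
Proof. by apply: mulr_ge0; [apply: mulr_ge0|exact: scaled_ge0]. Qed.

Let D_ge0 j a : 0 <= D j a. Proof. exact: nth_root_ge0. Qed.

Lemma osc_good_slice j (a x y : pt k) i t :
  (j <= k)%N -> i \in J -> same_block j t (a i) ->
  good_slice G a j J i t -> inbox (upd a i t) j (J :\ i) x -> inbox (upd a i t) j (J :\ i) y ->
  `|F x - F y| <= D j a.
Proof.
move=> jk iJ ta gt bx by_; apply: le_root => //.
have cJi : #|(J :\ i)%SET| = d by move: cJ; rewrite (cardsD1 i) iJ add1n => -[].
apply: (le_trans (IH cJi jk bx by_)).
have -> : (n - d = (n - d.+1).+1)%N by lia.
rewrite exprSr /scaled [4 * K]mulrC -!mulrA ler_wpM2l//.
rewrite (mulrCA 4) ler_wpM2l ?exprn_ge0//.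
Qed.

(* Halving the side of the box divides the [n]-th power of [D] by at least two,
   so [D] shrinks by any factor whose [n]-th power is at least one half; by
   Bernoulli's inequality [1 - 1 / (2 n)] is one. *)
Let ratio : R := 1 - (2 * n%:R)^-1.

Let ratio_ge0 : 0 <= ratio.
Proof.
rewrite subr_ge0 invf_le1 ?mulr_gt0 ?ltr0n//.
by rewrite -natrM ler1n muln_gt0.
Qed.

Let ratio_lt1 : ratio < 1.
Proof. by rewrite ltrBlDr ltrDl invr_gt0 mulr_gt0 ?ltr0n. Qed.

Let ratio_expr : 2^-1 <= ratio ^+ n.
Proof.
have h m (x : R) : 0 <= x -> x <= 1 -> 1 - m%:R * x <= (1 - x) ^+ m.
  move=> x0 x1; elim: m => [|m IHm]; first by rewrite expr0; lra.
  rewrite exprSr -natr1.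
  have : (1 - m%:R * x) * (1 - x) <= (1 - x) ^+ m * (1 - x).
    by apply: ler_wpM2r => //; lra.
  apply: le_trans; have : 0 <= m%:R * x * x by rewrite !mulr_ge0.
  by nra.
have n0' : 0 < n%:R :> R by rewrite ltr0n.
apply: le_trans (h n (2 * n%:R)^-1 _ _).
- by rewrite invfM mulrCA divff ?gt_eqF//; lra.
- by rewrite invr_ge0 mulr_ge0.
- by have := ratio_ge0; rewrite /ratio; lra.
Qed.

Lemma D_shrink j a : D j a <= ratio * D j.+1 a.
Proof.
have h : 4 * K * scaled j a <= 2^-1 * (4 * K * scaled j.+1 a).
  rewrite [leRHS]mulrCA ler_wpM2l ?mulr_ge0//.
  have h1 := box_energyS G0 a j J.
  rewrite /scaled; have [p ->] : exists p, (n - d.+1 = p.+1)%N by exists (n - d.+1).-1; lia.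
  have h2 : 2 ^+ j ^+ p.+1 <= 2^-1 * 2 ^+ j.+1 ^+ p.+1 :> R.
    rewrite [2 ^+ j.+1]exprS exprMn mulrA [2 ^+ p.+1]exprS mulKf//.
    by rewrite ler_peMl ?exprn_ge0// exprn_ege1// ler1n.
  rewrite mulrA; apply: ler_pM => //; exact: box_energy_ge0.
rewrite -(@ler_pXn2r _ n)// ?nnegrE ?mulr_ge0//.
rewrite exprMn !nth_root_expr//; apply: (le_trans h).
by rewrite ler_wpM2r.
Qed.

Lemma pos_good_slice i j (x : pt k) : (j <= k)%N -> i \in J ->
  exists2 t, same_block j t (x i) & good_slice G x j J i t.
Proof.
move=> jk iJ.
have [| |t] := @good_slice_exists R n k G G0 x j J i (block j (x i)) iJ.
- by move=> t; rewrite mem_block.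
- by have := card_block (x i) jk; lia.
- by rewrite mem_block => h1 h2; exists t.
Qed.

(* The solution of [B = B * ratio + 3]: one step of the descent costs at most
   three times [D j.+1], on top of the bound for the smaller box. *)
Let B := 3 / (1 - ratio).

Let B_ge0 : 0 <= B. Proof. by rewrite divr_ge0// subr_ge0 ltW. Qed.

(** Induction on the scale. The chosen slice at scale [j + 1] may miss the small
    box around [x], but a good slice of the large box in the other direction
    [i2] can be chosen through the small box. The path from [x] runs to a good
    slice of the small box, inside it to the [i2]-slice, along the [i2]-slice
    and then inside the chosen slice. *)
Lemma to_good_slice i1 i2 (i12 : i1 != i2) j (x : pt k) t :
  i1 \in J -> i2 \in J -> (j <= k)%N ->
  same_block j t (x i1) -> good_slice G x j J i1 t ->
  `|F x - F (upd x i1 t)| <= B * D j x.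
Proof.
move=> i1J i2J; elim: j t => [|j IHj] t jk tx gt.
  have -> : t = x i1 by apply: val_inj; move: tx; rewrite /same_block expn0 !divn1 => /eqP.
  by rewrite upd_id subrr normr0 mulr_ge0.
have jk' : (j <= k)%N by exact: ltnW.
have [t1 t1x gt1] := pos_good_slice x jk' i1J.
have [| |t2] := @good_slice_exists R n k G G0 x j.+1 J i2 (block j (x i2)) i2J.
- by move=> t'; rewrite mem_block; exact: same_blockS.
- by rewrite expnS; apply: leq_mul => //; exact: card_block.
rewrite mem_block => t2x gt2.
have h1 := IHj _ jk' t1x gt1.
pose q := upd (upd x i1 t1) i2 t2; pose q' := upd (upd x i1 t) i2 t2.
have i21 : i2 != i1 by rewrite eq_sym.
have h2 : `|F (upd x i1 t1) - F q| <= D j x.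
  apply: (osc_good_slice jk' i1J t1x gt1); first exact: inbox_refl.
  by apply: inbox_upd; rewrite ?inbox_refl ?in_setD1 ?i21 ?updE ?(negbTE i21).
have h3 : `|F q - F q'| <= D j.+1 x.
  have t2x' := same_blockS t2x.
  apply: (osc_good_slice jk i2J t2x' gt2); rewrite /q /q' (updC _ _ _ i12);
    apply: inbox_upd; rewrite ?inbox_refl ?in_setD1 ?i12 ?updE ?(negbTE i12)//.
  exact: same_blockS.
have h4 : `|F q' - F (upd x i1 t)| <= D j.+1 x.
  apply: (osc_good_slice jk i1J tx gt); last exact: inbox_refl.
  apply: inbox_upd; rewrite ?inbox_refl ?in_setD1 ?i21 ?updE ?(negbTE i21)//.
  exact: same_blockS.
apply: le_trans (step_arith B_ge0 (ltW ratio_lt1) (D_ge0 j.+1 x) (D_shrink j x) _); last first.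
  by rewrite /B; field; rewrite subr_eq0 gt_eqF.
exact: dist_chain4 h1 h2 h3 h4.
Qed.

Lemma morrey_step_bound i1 i2 (i12 : i1 != i2) j a x y : i1 \in J -> i2 \in J -> (j <= k)%N ->
  inbox a j J x -> inbox a j J y -> `|F x - F y| <= (2 * B + 1) * D j a.
Proof.
move=> i1J i2J jk ax ay.
have [t ta gt] := pos_good_slice a jk i1J.
have tr z : inbox a j J z -> same_block j t (z i1) /\ good_slice G z j J i1 t /\
    inbox (upd a i1 t) j (J :\ i1) (upd z i1 t) /\ D j z = D j a.
  move=> az; have /inboxP/(_ i1) := az; rewrite i1J => az1.
  have tz : same_block j t (z i1) by rewrite /same_block (eqP az1).
  have az' : inbox (upd a i1 t) j (J :\ i1) (upd z i1 t).
    rewrite -inbox_slice// updE eqxx eqxx andbT; exact: inbox_upd.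
  split => //; split; last by rewrite /D /scaled (box_energy_eq _ az).
  by rewrite /good_slice (box_energy_eq _ az) (box_energy_eq _ az').
have [tx [gx [bx Dx]]] := tr x ax; have [ty [gy [by_ Dy]]] := tr y ay.
have h1 := to_good_slice i12 i1J i2J jk tx gx; rewrite Dx in h1.
have h2 := to_good_slice i12 i1J i2J jk ty gy; rewrite Dy distrC in h2.
have h3 := osc_good_slice jk i1J ta gt bx by_.
have -> : (2 * B + 1) * D j a = B * D j a + D j a + B * D j a + 0 by ring.
by apply: dist_chain4 h1 h3 h2 _; rewrite subrr normr0.
Qed.

Lemma morrey_step_expr i1 i2 (i12 : i1 != i2) j a x y : i1 \in J -> i2 \in J -> (j <= k)%N ->
  inbox a j J x -> inbox a j J y ->
  `|F x - F y| ^+ n <= (2 * B + 1) ^+ n * (4 * K) * (2 ^+ j) ^+ (n - d.+1) * box_energy G a j J.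
Proof.
move=> i1J i2J jk ax ay; have h := morrey_step_bound i12 i1J i2J jk ax ay.
rewrite [leRHS](_ : _ = ((2 * B + 1) * D j a) ^+ n); last first.
  by rewrite exprMn [D j a ^+ n]nth_root_expr// /scaled !mulrA.
rewrite lerXn2r// nnegrE//; apply: mulr_ge0; last exact: D_ge0.
by apply: addr_ge0 => //; apply: mulr_ge0 => //; exact: B_ge0.
Qed.

End MorreyStep.

Lemma morrey d : (0 < d < n)%N -> morrey_dim d.
Proof.
elim: d => // -[_ /andP[_]|d IHd dn]; first exact: morrey1.
have [|K K0 IH] := IHd; first by lia.
pose B : R := 3 / (1 - (1 - (2 * n%:R)^-1)).
exists ((2 * B + 1) ^+ n * (4 * K)).
  by rewrite mulr_ge0 ?mulr_ge0// exprn_ge0// addr_ge0// mulr_ge0// divr_ge0//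
    subKr invr_ge0 mulr_ge0.
move=> k F G FG J j a x y cJ jk ax ay.
have [i1 i1J] : exists i, i \in J by apply/set0Pn; rewrite -card_gt0 cJ.
have [i2] : exists i, i \in (J :\ i1)%SET.
  by apply/set0Pn; rewrite -card_gt0; move: cJ; rewrite (cardsD1 i1) i1J add1n => -[->].
rewrite in_setD1 => /andP[i21 i2J].
apply: (morrey_step_expr _ K0 FG (IH k F G FG) cJ _ i1J i2J jk ax ay); first by lia.
by rewrite eq_sym.
Qed.

End Morrey.

(** A slice of the whole grid has [d = n - 1], hence oscillation bounded by the
    side times the energy of the slice; by Chebyshev few slices have a large
    energy. *)
Lemma morrey_slices (R : realType) (n : nat) : (1 < n)%N ->
  exists2 K : R, 0 <= K & forall k (F G : {ffun 'I_n -> 'I_(2 ^ k)} -> R), grid_bound F G ->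
  forall (i : 'I_n) tau, 0 <= tau -> exists2 bad : {set 'I_(2 ^ k)},
    tau * #|bad|%:R <= 2 ^+ k * \sum_x G x &
    forall t (x y : {ffun 'I_n -> 'I_(2 ^ k)}), t \notin bad -> x i = t -> y i = t ->
      `|F x - F y| ^+ n <= K * tau.
Proof.
move=> n1; have [|K K0 HK] := @morrey R n n.-1; first by lia.
exists K => // k F G FG i tau tau0.
have [G0 _] := FG.
pose slice_energy (t : 'I_(2 ^ k)) := \sum_(x : {ffun 'I_n -> 'I_(2 ^ k)} | x i == t) G x.
pose bad : {set 'I_(2 ^ k)} := finset (fun t => tau < 2 ^+ k * slice_energy t).
exists bad.
  have : \sum_(t in bad) tau <= \sum_(t in bad) 2 ^+ k * slice_energy t.
    by apply: ler_sum => t; rewrite finset.in_set => /ltW.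
  rewrite sumr_const mulr_natr => /le_trans; apply.
  rewrite -mulr_sumr ler_wpM2l ?exprn_ge0//.
  rewrite [leRHS](partition_big (fun x : {ffun 'I_n -> 'I_(2 ^ k)} => x i) predT)//=.
  rewrite [leRHS](bigID (mem bad))/= -[leLHS]addr0 lerD//.
  by apply: sumr_ge0 => t _; apply: sumr_ge0.
move=> t x y; rewrite finset.in_set -leNgt => tb xt yt.
pose J : {set 'I_n} := ([set: 'I_n] :\ i)%SET.
have cJ : #|J| = n.-1.
  have := cardsD1 i [set: 'I_n]%SET.
  by rewrite finset.in_setT cardsT card_ord add1n => /(congr1 predn)/=->.
have inb z : inbox x k J z = (z i == t).
  apply/inboxP/eqP => [/(_ i)|zt l].
    by rewrite /J !finset.inE eqxx/= xt => /eqP.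
  by rewrite /J !finset.inE andbT; case: eqVneq => [->|_] /=; rewrite ?zt ?xt// same_block_top.
have := HK k F G FG J k x x y cJ (leqnn k) (inbox_refl _ _ _).
rewrite inb yt eqxx => /(_ isT) /le_trans; apply.
have -> : (n - n.-1 = 1)%N by lia.
rewrite expr1 -mulrA ler_wpM2l//; apply: le_trans tb.
by rewrite /box_energy (eq_bigl _ _ inb).
Qed.

(** * Volume of disjoint cubes *)

Section RowNorm.
Variables (R : realType) (n : nat).
Implicit Types (v w : 'rV[R]_n) (r : R).

Lemma row_coord_le v i : `|v 0 i| <= `|v|.
Proof.
rewrite [leRHS]/Num.norm/= mx_normrE.
by apply: (le_trans _ (le_bigmax _ (fun ij => `|v ij.1 ij.2|) (0, i))).
Qed.

Lemma row_norm_le v r : 0 <= r -> (forall i, `|v 0 i| <= r) -> `|v| <= r.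
Proof.
move=> r0 h; rewrite [leLHS]/Num.norm/= mx_normrE; apply: bigmax_le => // -[i j] _ /=.
by rewrite ord1.
Qed.

Lemma row_norm_lt v r : 0 < r -> (forall i, `|v 0 i| < r) -> `|v| < r.
Proof.
move=> r0 h; rewrite [ltLHS]/Num.norm/= mx_normrE; apply: bigmax_lt => // -[i j] _ /=.
by rewrite ord1.
Qed.
End RowNorm.

Section Volume.
Variables (R : realType) (n : nat).

(** Instead of measuring volumes one counts the points of a fine lattice: those
    of the large cube number [N ^ n], and each lies in one small cube at most.
    A small cube of width [2 * rho i], wider than the mesh [h], contains at
    least [(rho i / h) ^+ n] of them; half of the width is given away. *)
Lemma disjoint_cubes_volume (I : finType) (w : I -> 'rV[R]_n) (rho : I -> R)
    (a : 'rV[R]_n) (r : R) : 0 < r ->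
  (forall i, 0 < rho i) -> (forall i, `|w i - a| + rho i <= r) ->
  (forall i j y, i != j -> `|y - w i| < rho i -> `|y - w j| < rho j -> False) ->
  \sum_i rho i ^+ n <= (2 * r) ^+ n.
Proof.
move=> r0 rho0 inside disj.
pose N := (Num.trunc (\sum_i 2 * r / rho i)).+1.
have N0 : 0 < N%:R :> R by rewrite ltr0n.
have Nrho i : 2 * r < N%:R * rho i.
  rewrite -ltr_pdivrMr//; apply: le_lt_trans (truncnS_gt _).
  by rewrite (bigD1 i)//= lerDl sumr_ge0// => j _; rewrite !mulr_ge0 ?invr_ge0 ?ltW.
pose h := 2 * r / N%:R; have h0 : 0 < h by rewrite divr_gt0// mulr_gt0.
pose g (x : {ffun 'I_n -> 'I_N}) : 'rV[R]_n := \row_l (a 0 l - r + h * (x l)%:R).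
pose X i := finset (fun x => `|g x - w i| < rho i).
have count : (\sum_i #|X i| <= N ^ n)%N.
  have -> : (N ^ n = \sum_(x : {ffun 'I_n -> 'I_N}) 1)%N.
    by rewrite sum1_card card_ffun !card_ord.
  under eq_bigr do rewrite -sum1_card big_mkcond/=.
  rewrite exchange_big/=; apply: leq_sum => x _.
  case: (pickP (fun i => x \in X i)) => [i xi|nx].
    rewrite (bigD1 i)//= xi big1// => j ji; case: ifP => // xj.
    by case: (disj i j (g x)); rewrite 1?eq_sym//; [move: xi|move: xj]; rewrite finset.in_set.
  by rewrite big1// => i _; rewrite nx.
have X_ge i : (rho i / h) ^+ n <= #|X i|%:R.
  pose q := rho i / h; have q1 : 1 < q.
    by rewrite /q /h invf_div mulrA ltr_pdivlMr ?mulr_gt0// mul1r [ltRHS]mulrC; exact: Nrho.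
  have q0 : 0 <= q by lra.
  pose m := (Num.trunc q).+1.
  have /andP[m1 m2] := truncn_itv q0; rewrite -/m in m2.
  pose x0 (l : 'I_n) := (w i 0 l - rho i - a 0 l + r) / h.
  have hx l : h * x0 l = w i 0 l - rho i - a 0 l + r by rewrite mulrC divfK// gt_eqF.
  have hq : h * q = rho i by rewrite mulrC divfK// gt_eqF.
  have hN : h * N%:R = 2 * r by rewrite divfK// gt_eqF.
  have wa l : `|w i 0 l - a 0 l| + rho i <= r.
    by apply: le_trans (inside i); rewrite lerD2r; have := row_coord_le (w i - a) l; rewrite !mxE.
  have x00 l : 0 <= x0 l.
    apply: divr_ge0; last exact: ltW.
    have := wa l; have := ler_norm (- (w i 0 l - a 0 l)).
    by rewrite normrN; lra.
  have xN l : x0 l + 2 * q <= N%:R.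
    rewrite -(ler_pM2l h0) mulrDr hx hN mulrCA hq.
    by have := wa l; have := ler_norm (w i 0 l - a 0 l); lra.
  (* The lattice points strictly inside the cube start at index [s0 l] in
     direction [l], and [m] of them in a row fit. *)
  pose s0 l := (Num.trunc (x0 l)).+1.
  have s0P l : x0 l < (s0 l)%:R /\ (s0 l)%:R <= x0 l + 1.
    by have /andP[h1 h2] := truncn_itv (x00 l); rewrite /s0 -natr1 in h2 *; split; lra.
  have s0t l (t : 'I_m) : (s0 l + t)%:R < x0 l + 2 * q.
    have [_ h2] := s0P l; have : (t%:R <= (Num.trunc q)%:R :> R) by rewrite ler_nat -ltnS.
    by rewrite natrD; lra.
  have ltN l (t : 'I_m) : (s0 l + t < N)%N.
    by rewrite -(ltr_nat R); exact: lt_le_trans (s0t _ _) (xN l).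
  pose f (t : {ffun 'I_n -> 'I_m}) : {ffun 'I_n -> 'I_N} := [ffun l => Ordinal (ltN l (t l))].
  have finj : injective f.
    move=> t t' /ffunP E; apply/ffunP => l; have := E l.
    rewrite !ffunE => /(congr1 val)/= /addnI h'.
    exact: val_inj.
  apply: (@le_trans _ _ (m ^ n)%:R).
    by rewrite natrX lerXn2r// ?nnegrE// ltW.
  have <- : #|{: {ffun 'I_n -> 'I_m}}| = (m ^ n)%N by rewrite card_ffun !card_ord.
  rewrite ler_nat -cardsT -(card_imset _ finj).
  apply/subset_leq_card/fintype.subsetP => _ /imsetP[t _ ->].
  rewrite finset.in_set; apply: row_norm_lt => // l; rewrite !mxE ffunE /=.
  have h1 := s0t l (t l); have [h2 _] := s0P l.
  have h3 : x0 l < (s0 l + t l)%:R by apply: lt_le_trans h2 _; rewrite ler_nat leq_addr.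
  rewrite -(ltr_pM2l h0) in h1; rewrite -(ltr_pM2l h0) in h3.
  rewrite mulrDr hx mulrCA hq in h1; rewrite hx in h3.
  by rewrite ltr_norml; apply/andP; split; lra.
have : \sum_i (rho i / h) ^+ n <= (N ^ n)%:R.
  apply: le_trans (_ : (\sum_i #|X i|)%:R <= _); last by rewrite ler_nat.
  by rewrite natr_sum; apply: ler_sum.
under eq_bigr do rewrite expr_div_n.
rewrite -mulr_suml ler_pdivrMr ?exprn_gt0// => /le_trans; apply.
by rewrite natrX -exprMn mulrC divfK// gt_eqF.
Qed.
Lemma disjoint_cubes_volume_cond (I : finType) (P : {pred I}) (w : I -> 'rV[R]_n)
    (rho : I -> R) (a : 'rV[R]_n) (r : R) : 0 < r ->
  {in P, forall i, 0 < rho i} -> {in P, forall i, `|w i - a| + rho i <= r} ->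
  {in P &, forall i j, forall y, i != j -> `|y - w i| < rho i -> `|y - w j| < rho j -> False} ->
  \sum_(i in P) rho i ^+ n <= (2 * r) ^+ n.
Proof.
move=> r0 rho0 inside disj; rewrite big_sub.
apply: (@disjoint_cubes_volume {i in P} (w \o val) (rho \o val) a) => // [i|i|i j y ij].
- exact: rho0 (valP i).
- exact: inside (valP i).
- exact: disj (valP i) (valP j) y ij.
Qed.
End Volume.

(** * Strict differentiability of continuously differentiable maps *)

Lemma diff_eps (R : realType) (V W : normedModType R) (f : V -> W)
    (df : {linear V -> W}) (a : V) : continuous df ->
  (forall eps, 0 < eps -> exists2 d, 0 < d &
    forall v, `|v| < d -> `|f (v + a) - f a - df v| <= eps * `|v|) ->
  'd f a = df :> (V -> W).
Proof.
move=> cdf h; apply: diff_unique => //; apply/eqaddoP => eps eps0.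
have [d d0 hd] := h _ eps0; apply/nbhs_ballP; exists d => //= v.
rewrite -ball_normE/= sub0r normrN => /hd.
by rewrite opprD !addrA.
Qed.

Section StrictDerivative.
Variables (R : realType) (n : nat).
Local Notation e_ i := (delta_mx 0 i : 'rV[R]_n).

Lemma derive_along (g : 'rV[R]_n -> R) (y v : 'rV[R]_n) (t : R) :
  derivable g (y + t *: v) v ->
  is_derive t 1 (fun s : R => g (y + s *: v)) ('D_v g (y + t *: v)).
Proof.
have E : (fun h : R => h^-1 *:
      (((fun s : R => g (y + s *: v)) \o shift t) (h *: 1) - g (y + t *: v))) =
   (fun h : R => h^-1 *: ((g \o shift (y + t *: v)) (h *: v) - g (y + t *: v))).
  by apply/funext => h /=; rewrite [h%:A]mulr1 scalerDl addrA [h *: v + _]addrC addrAC.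
by move=> dg; apply: DeriveDef; rewrite /derivable /derive E.
Qed.

Lemma coord_mvt (g : 'rV[R]_n -> R) (y v : 'rV[R]_n) (s : R) :
  (forall t, `|t| <= `|s| -> derivable g (y + t *: v) v) ->
  exists2 t, `|t| <= `|s| & g (y + s *: v) - g y = s * 'D_v g (y + t *: v).
Proof.
move=> dg.
have main a b : a <= b -> (forall t, t \in `[a, b] -> `|t| <= `|s|) ->
    exists2 t, `|t| <= `|s| & g (y + b *: v) - g (y + a *: v) = 'D_v g (y + t *: v) * (b - a).
  move=> ab abs.
  have [t||t tab E] := @MVT_segment R (fun s : R => g (y + s *: v))
     (fun t => 'D_v g (y + t *: v)) a b ab.
  - by move=> tab; apply: derive_along; apply: dg; apply: abs; exact: subset_itv_oo_cc.
  - apply: derivable_within_continuous => t tab.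
    by have [] := derive_along (dg t (abs t tab)).
  by exists t => //; exact: abs.
have [s0|s0] := leP 0 s.
  have [||t ts E] := main 0 s => //.
    by move=> t; rewrite in_itv/= => /andP[t0 ts]; rewrite !ger0_norm.
  by exists t => //; move: E; rewrite scale0r addr0 subr0 => ->; rewrite mulrC.
have [||t ts E] := main s 0; first exact: ltW.
  move=> t; rewrite in_itv/= => /andP[t0 ts].
  by rewrite ler0_norm// ltr0_norm// lerN2.
exists t => //; move: E; rewrite scale0r addr0 sub0r mulrN => E.
by rewrite -opprB E opprK mulrC.
Qed.

Definition partials (f : 'rV[R]_n -> 'rV[R]_n) (a : 'rV[R]_n) : 'M[R]_n :=
  \matrix_(i, j) ('D_(e_ i) f a) 0 j.

Lemma mulmx_norm_le (v : 'rV[R]_n) (P : 'M[R]_n) : `|v *m P| <= n%:R * `|P| * `|v|.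
Proof.
apply: row_norm_le => [|j]; first by rewrite !mulr_ge0.
rewrite mxE; apply: (le_trans (ler_norm_sum _ _ _)).
apply: (@le_trans _ _ (\sum_(i < n) `|P| * `|v|)); last first.
  by rewrite sumr_const card_ord -[leLHS]mulr_natl mulrA.
apply: ler_sum => i _; rewrite normrM mulrC; apply: ler_pM => //; last exact: row_coord_le.
rewrite [leRHS]/Num.norm/= mx_normrE.
by apply: (le_trans _ (le_bigmax _ (fun ij => `|P ij.1 ij.2|) (i, j))).
Qed.

(* The path from [y] to [y'] that changes one coordinate at a time. *)
Let mix (y y' : 'rV[R]_n) (k : nat) : 'rV[R]_n :=
  \row_l if (l < k)%N then y' 0 l else y 0 l.

Let mixS y y' (k : 'I_n) : mix y y' k.+1 = mix y y' k + (y' 0 k - y 0 k) *: e_ k.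
Proof.
apply/rowP => l; rewrite !mxE eqxx/= ltnS leq_eqVlt.
have [->|lk] := eqVneq l k; first by rewrite eqxx ltnn/= mulr1; ring.
by rewrite val_eqE (negbTE lk) /= mulr0 addr0.
Qed.

Let mix0 y y' : mix y y' 0 = y. Proof. by apply/rowP => l; rewrite mxE. Qed.
Let mixn y y' : mix y y' n = y'. Proof. by apply/rowP => l; rewrite mxE ltn_ord. Qed.

(** The mean value theorem along each edge of the path [mix]. The intermediate
    points stay within [3 * d] of [a]: a corner of the path is within [d], and
    an edge is shorter than [2 * d]. *)
Lemma strict_estimate (f : 'rV[R]_n -> 'rV[R]_n) (a : 'rV[R]_n) (d eta : R) :
  0 < d -> 0 <= eta ->
  (forall i y, `|y - a| < 3 * d -> derivable f y (e_ i) /\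
     `|'D_(e_ i) f y - 'D_(e_ i) f a| <= eta) ->
  forall y y', `|y - a| < d -> `|y' - a| < d ->
    `|f y' - f y - (y' - y) *m partials f a| <= n%:R * eta * `|y' - y|.
Proof.
move=> d0 eta0 hf y y' ya y'a; apply: row_norm_le => [|j]; first by rewrite !mulr_ge0.
pose g x := f x 0 j.
have gD x i : `|x - a| < 3 * d -> derivable g x (e_ i) /\
    'D_(e_ i) g x = ('D_(e_ i) f x) 0 j.
  by move=> /(hf i)[fd _]; split; [apply/(derivable_mxP _ _ _).1|rewrite derive_mx// mxE].
pose u k := g (mix y y' k).
have mixa k : `|mix y y' k - a| < d.
  apply: row_norm_lt => // l; rewrite !mxE.
  have h1 := row_coord_le (y - a) l; have h2 := row_coord_le (y' - a) l.
  rewrite !mxE in h1 h2.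
  by case: ifP => _; [apply: le_lt_trans h2 _|apply: le_lt_trans h1 _].
have yy : `|y' - y| < 2 * d.
  rewrite (_ : y' - y = (y' - a) - (y - a)); last by rewrite opprB addrA subrK.
  by apply: (le_lt_trans (ler_normB _ _)); lra.
have step (k : 'I_n) : `|u k.+1 - u k - (y' 0 k - y 0 k) * partials f a k j| <= eta * `|y' - y|.
  have sk : `|y' 0 k - y 0 k| <= `|y' - y| by have := row_coord_le (y' - y) k; rewrite !mxE.
  have near_a t : `|t| <= `|y' 0 k - y 0 k| -> `|mix y y' k + t *: e_ k - a| < 3 * d.
    move=> tk; rewrite addrAC; apply: (le_lt_trans (ler_normD _ _)).
    have : `|t *: e_ k| <= `|t|.
      rewrite normrZ ler_piMr//; apply: row_norm_le => // l; rewrite mxE /=.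
      by case: (l == k); rewrite ?normr1 ?normr0.
    by have := mixa k; lra.
  have [|t tk E] := @coord_mvt g (mix y y' k) (e_ k) (y' 0 k - y 0 k).
    by move=> t tk; have [] := gD _ k (near_a t tk).
  rewrite /u mixS E mxE -mulrBr normrM [leRHS]mulrC.
  have [_ ->] := gD _ k (near_a t tk).
  apply: ler_pM => //.
  have [_] := hf k _ (near_a t tk); apply: le_trans.
  by have := row_coord_le ('D_(e_ k) f (mix y y' k + t *: e_ k) - 'D_(e_ k) f a) j; rewrite !mxE.
have -> : (f y' - f y - (y' - y) *m partials f a) 0 j =
    \sum_(k < n) (u k.+1 - u k - (y' 0 k - y 0 k) * partials f a k j).
  rewrite big_split/= sumrN -(big_mkord predT (fun k => u k.+1 - u k)) telescope_sumr//.
  rewrite /u mix0 mixn /g !mxE; congr (_ - _).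
  by apply: eq_bigr => k _; rewrite !mxE.
apply: (le_trans (ler_norm_sum _ _ _)).
apply: (le_trans (ler_sum _ (fun k _ => step k))).
by rewrite sumr_const card_ord -[leLHS]mulr_natl mulrA.
Qed.

(** Strict differentiability controls differences between two arbitrary points
    near [a], as needed for cubes that are not centred at [a]. *)
Lemma C1_strict (U : set 'rV[R]_n) (f : 'rV[R]_n -> 'rV[R]_n) (a : 'rV[R]_n) :
  open U -> U a -> Ck_on 1 U f -> forall eta, 0 < eta -> exists2 d, 0 < d &
  forall y y', `|y - a| < d -> `|y' - a| < d ->
    `|f y' - f y - (y' - y) *m partials f a| <= eta * `|y' - y|.
Proof.
move=> Uo Ua [_ Cf] eta eta0.
pose eta' := eta / n.+1%:R; have eta'0 : 0 < eta' by rewrite divr_gt0.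
pose Q i y := U y /\ `|'D_(e_ i) f y - 'D_(e_ i) f a| <= eta'.
have hQ i : nbhs a (Q i).
  apply: filterI; first exact: open_nbhs_nbhs.
  have [_ [cD _]] := Cf i.
  exact: ((cvgrPdistC_le _ _).1 (cD a Ua) eta' eta'0).
have : nbhs a [set y | forall i, Q i y] by exact: (@filter_forall _ _ Q (nbhs a) _ hQ).
move=> /nbhs_ballP[r /= r0 rU].
exists (r / 3); first by rewrite divr_gt0.
move=> y y' ya y'a.
have h := @strict_estimate f a (r / 3) eta' _ (ltW eta'0) _ y y' ya y'a.
apply: le_trans (h _ _) _; first by rewrite divr_gt0.
  move=> i x xa; have [|Ux ?] := rU x _ i.
    by rewrite -ball_normE/= distrC; apply: lt_le_trans xa _; lra.
  by split => //; have [/(_ x Ux)] := Cf i.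
rewrite ler_wpM2r// /eta' mulrCA; apply: ler_piMr; first exact: ltW.
by rewrite ler_pdivrMr// mul1r ler_nat.
Qed.

Lemma partials_jacobian (U : set 'rV[R]_n) (f : 'rV[R]_n -> 'rV[R]_n) (a : 'rV[R]_n) :
  open U -> U a -> Ck_on 1 U f -> 'J f a = partials f a.
Proof.
move=> Uo Ua Cf.
have cP : continuous (mulmxr (partials f a) : 'rV[R]_n -> 'rV[R]_n).
  apply: bounded_linear_continuous; apply/linear_boundedP.
  near=> r => v /=; apply: (le_trans (mulmx_norm_le v _)).
  by rewrite ler_wpM2r//; near: r; apply: nbhs_pinfty_ge; rewrite num_real.
have E' : 'd f a = mulmxr (partials f a) :> ('rV[R]_n -> 'rV[R]_n).
  apply: diff_eps => // eps eps0; have [d d0 h] := C1_strict Uo Ua Cf eps0.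
  exists d => // v vd; have := h a (v + a); rewrite subrr normr0 addrK => /(_ d0 vd).
  exact.
apply/row_matrixP => i; rewrite !rowE /jacobian mul_rV_lin1 E'//.
Unshelve. all: by end_near. Qed.

End StrictDerivative.

(** * Charts and Gram forms *)

Lemma closed_cube_compact (R : realType) n (a : 'rV[R]_n) (r : R) :
  compact [set y | `|y - a| <= r].
Proof.
have -> : [set y | `|y - a| <= r] = closed_ball_ (fun x => `|x|) a r.
  by apply/seteqP; split => y; rewrite /closed_ball_/= distrC.
apply: bounded_closed_compact; last exact: closed_closed_ball_.
exists (`|a| + r); split; first by rewrite num_real.
move=> M Mar y; rewrite /closed_ball_/= distrC => yr.
apply: le_trans (ltW Mar); rewrite -{1}(subrK a y) addrC.
by apply: (le_trans (ler_normD _ _)); rewrite lerD2l.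
Qed.

Section Chart.
Variables (R : realType) (n : nat) (T : topologicalType) (c : chart R n T).

Lemma cmap_cts x : cdom c x -> {for x, continuous (cmap c)}.
Proof.
move=> cx; have := @cmap_continuous _ _ _ c.
by rewrite continuous_open_subspace; [apply; exact/mem_set|exact: cdom_open].
Qed.

Lemma cinv_cts y : crange c y -> {for y, continuous (cinv c)}.
Proof.
move=> cy; have := @cinv_continuous _ _ _ c.
by rewrite continuous_open_subspace; [apply; exact/mem_set|exact: crange_open].
Qed.

Lemma chart_nbhs x r : cdom c x -> 0 < r ->
  nbhs x [set p | cdom c p /\ `|cmap c p - cmap c x| < r].
Proof.
move=> cx r0; apply: filterI; first exact: (open_nbhs_nbhs (conj (cdom_open c) cx)).
have /cvgrPdist_lt/(_ r r0) := cmap_cts cx.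
by apply: filterS => p /=; rewrite distrC.
Qed.

Lemma cinv_nbhs y U : crange c y -> nbhs (cinv c y) U ->
  exists2 r, 0 < r & forall z, `|z - y| < r -> crange c z /\ U (cinv c z).
Proof.
move=> cy nU; have /nbhs_ballP[r /= r0 rU] : nbhs y (crange c `&` (cinv c @^-1` U)).
  apply: filterI; first by apply: open_nbhs_nbhs; split => //; exact: crange_open.
  exact: (cinv_cts cy).
by exists r => // z zy; apply: rU; rewrite -ball_normE/= distrC.
Qed.

Lemma chart_ball_open a r : open [set p | cdom c p /\ `|cmap c p - a| < r].
Proof.
rewrite openE => p [cp pa]; have r0 : 0 < r - `|cmap c p - a| by rewrite subr_gt0.
apply: filterS (chart_nbhs cp r0) => q [cq qp]; split => //.
have -> : cmap c q - a = (cmap c q - cmap c p) + (cmap c p - a) by rewrite addrA subrK.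
by apply: (le_lt_trans (ler_normD _ _)); lra.
Qed.

(** Compact sets are closed in a Hausdorff space; without that hypothesis the
    image of a closed cube could have limit points outside the chart. *)
Lemma chart_closed_cube a r : hausdorff_space T -> (forall y, `|y - a| <= r -> crange c y) ->
  closed [set p | cdom c p /\ `|cmap c p - a| <= r].
Proof.
move=> hT ar.
have -> : [set p | cdom c p /\ `|cmap c p - a| <= r] = cinv c @` [set y | `|y - a| <= r].
  apply/seteqP; split => [p [cp pa]|_ [y ya <-]]; first by exists (cmap c p) => //; rewrite cmapK.
  by have cy := ar _ ya; split; [exact: cinv_sub|rewrite cinvK].
apply: compact_closed => //; apply: continuous_compact; last exact: closed_cube_compact.
by apply: continuous_subspaceW (@cinv_continuous _ _ _ c).
Qed.

End Chart.

Lemma cvg_sum (R : realType) (T : Type) (F : set_system T) {FF : Filter F} (I : Type)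
  (r : seq I) (f : I -> T -> R) (l : I -> R) :
  (forall i, f i x @[x --> F] --> l i) ->
  (\sum_(i <- r) f i x) @[x --> F] --> \sum_(i <- r) l i.
Proof.
move=> fl; elim: r => [|i r IH].
  by rewrite big_nil; under eq_fun do rewrite big_nil; exact: cvg_cst.
by rewrite big_cons; under eq_fun do rewrite big_cons; exact: cvgD.
Qed.

Section GramForm.
Variables (R : realType) (n : nat).
Implicit Types (G : 'M[R]_n) (v w : 'rV[R]_n).

Definition gram_form G v := (v *m G *m v^T) 0 0.

Lemma gram_form_congr J G v : gram_form (J *m G *m J^T) v = gram_form G (v *m J).
Proof. by rewrite /gram_form trmx_mul !mulmxA. Qed.

Lemma gram_formZ k G v : gram_form (k *: G) v = k * gram_form G v.
Proof. by rewrite /gram_form -scalemxAr -scalemxAl mxE. Qed.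

Lemma gram_formB G G' v : gram_form (G - G') v = gram_form G v - gram_form G' v.
Proof. by rewrite /gram_form mulmxBr mulmxBl !mxE. Qed.

Lemma gram_form_scale k G v : gram_form G (k *: v) = k ^+ 2 * gram_form G v.
Proof. by rewrite /gram_form linearZ/= -!scalemxAl -scalemxAr !mxE; ring. Qed.

Lemma gram_form_le G v : `|gram_form G v| <= n%:R ^+ 2 * `|G| * `|v| ^+ 2.
Proof.
rewrite /gram_form mxE; apply: (le_trans (ler_norm_sum _ _ _)).
apply: (@le_trans _ _ (\sum_(i < n) n%:R * `|G| * `|v| * `|v|)).
  apply: ler_sum => i _; rewrite normrM; apply: ler_pM => //.
    exact: le_trans (row_coord_le _ _) (mulmx_norm_le _ _).
  by rewrite [v^T i 0]mxE row_coord_le.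
by rewrite sumr_const card_ord -[leLHS]mulr_natl expr2; lra.
Qed.

Lemma gram_form_cts G : continuous (gram_form G).
Proof.
move=> v; rewrite /gram_form.
have -> : (fun v : 'rV[R]_n => (v *m G *m v^T) 0 0) =
    (fun v => \sum_i (\sum_j v 0 j * G j i) * v 0 i).
  by apply/funext => w; rewrite mxE; apply: eq_bigr => i _; rewrite !mxE.
apply: (@cvg_sum _ _ (nbhs v)) => i; apply: cvgM; last exact: coord_continuous.
apply: (@cvg_sum _ _ (nbhs v)) => j; apply: cvgM; [exact: coord_continuous|exact: cvg_cst].
Qed.

Lemma gram_form_pos G : (forall v, v != 0 -> 0 < gram_form G v) ->
  exists2 m, 0 < m & forall v, m * `|v| ^+ 2 <= gram_form G v.
Proof.
move=> Gp.
pose sph := [set v : 'rV[R]_n | `|v| = 1].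
have csph : compact sph.
  have -> : sph = [set y | `|y - 0| <= 1] `&` [set y : 'rV[R]_n | `|y| = 1].
    by apply/seteqP; split => [v /= v1|v [_]//]; split; rewrite /= ?subr0 v1.
  apply: compact_closedI; first exact: closed_cube_compact.
  apply: (@preimage_closed _ _ (fun v : 'rV[R]_n => `|v|) [set 1]).
    by move=> v _; exact: norm_continuous.
  exact: closed_eq.
have [sph0|[v0 v01]] : sph = set0 \/ sph !=set0.
  by have [->|/set0P] := eqVneq sph set0; [left|right].
  exists 1 => // v; have [->|v0] := eqVneq v 0.
    by rewrite normr0 expr0n mulr0/= /gram_form !mul0mx mxE.
  have : sph (`|v|^-1 *: v) by rewrite /sph/= normrZ normfV normr_id mulVf// normr_eq0.
  by rewrite sph0.
have cf : {within sph, continuous (gram_form G)}.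
  by apply: continuous_subspaceT => v; exact: gram_form_cts.
have [v1 v11 hv1] := EVT_min_rV (ex_intro _ v0 v01) csph cf.
have v1n0 : v1 != 0 by rewrite -normr_eq0; move: v11; rewrite inE /sph/= => ->; rewrite oner_eq0.
exists (gram_form G v1); first exact: Gp.
move=> v; have [->|vn0] := eqVneq v 0.
  by rewrite normr0 expr0n mulr0/= /gram_form !mul0mx mxE.
have nv0 : `|v| != 0 by rewrite normr_eq0.
have := hv1 (`|v|^-1 *: v); rewrite inE /sph/= normrZ normfV normr_id mulVf// => /(_ erefl).
by rewrite gram_form_scale exprVn mulrC ler_pdivlMr// exprn_gt0// lt_def nv0 normr_ge0.
Qed.

End GramForm.
Lemma chart_segment_connected (R : realType) n (T : topologicalType) (c : chart R n T)
    (p v : 'rV[R]_n) :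
  (forall t : R, `[0, 1]%classic t -> crange c (p + t *: v)) ->
  connected ((fun t : R => cinv c (p + t *: v)) @` `[0, 1]%classic).
Proof.
move=> pv; apply: connected_continuous_connected.
  exact/connected_intervalP/interval_is_interval.
apply/continuous_in_subspaceT => t /set_mem/pv ct.
apply: (@continuous_comp _ _ _ (fun t : R => p + t *: v) (cinv c)); last exact: cinv_cts.
by apply: cvgD; [exact: cvg_cst|apply: cvgZr_tmp; exact: cvg_id].
Qed.

(** * Distortion of cubes between charts *)

Section ConformalGeometry.
Variables (R : realType) (n : nat) (M : manifold R n) (S : conformal_structure M).
Implicit Types (c d : chart R n M) (p : M) (g : local_metric M) (y z w v : 'rV[R]_n).

Lemma chart_image_open c V : open V -> open (cmap c @` (cdom c `&` V)).
Proof.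
move=> Vo; rewrite openE => _ [p [cp Vp] <-].
have nV : nbhs (cinv c (cmap c p)) V by rewrite cmapK//; exact: open_nbhs_nbhs.
have [r r0 h] := cinv_nbhs (cmap_sub cp) nV.
apply/nbhs_ballP; exists r => // z; rewrite -ball_normE/= distrC => /h[cz Vz].
by exists (cinv c z); [split => //; exact: cinv_sub|rewrite cinvK].
Qed.

Lemma transition_strict c d p : atlas c -> atlas d -> cdom c p -> cdom d p ->
  forall eta, 0 < eta -> exists2 r, 0 < r &
    forall y y', `|y - cmap c p| < r -> `|y' - cmap c p| < r ->
    `|transition c d y' - transition c d y
      - (y' - y) *m 'J (transition c d) (cmap c p)| <= eta * `|y' - y|.
Proof.
move=> Ac Ad cp dp eta eta0.
have [sm _] := (atlas_maximal M).1.2 c d Ac Ad.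
have Uo := @chart_image_open c _ (cdom_open d).
have Up : (cmap c @` (cdom c `&` cdom d)) (cmap c p) by exists p.
rewrite (partials_jacobian Uo Up (sm 1%N)).
exact: C1_strict Uo Up (sm 1%N) _ eta0.
Qed.

Lemma transition_lipschitz c d p : atlas c -> atlas d -> cdom c p -> cdom d p ->
  let J := 'J (transition c d) (cmap c p) in J != 0 ->
  exists2 r, 0 < r & forall y y', `|y - cmap c p| < r -> `|y' - cmap c p| < r ->
    `|transition c d y' - transition c d y| <= n.+1%:R * `|J| * `|y' - y|.
Proof.
move=> Ac Ad cp dp J J0.
have [|r r0 h] := transition_strict Ac Ad cp dp (eta := `|J|); first by rewrite normr_gt0.
exists r => // y y' yr y'r; have := h y y' yr y'r.
have := mulmx_norm_le (y' - y) J.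
set D := transition c d y' - _; rewrite -/J => h1 h2.
rewrite -(subrK ((y' - y) *m J) D); apply: (le_trans (ler_normD _ _)).
by rewrite -natr1; lra.
Qed.

(** [A] bounds the ratio of the lengths, for the metric, of vectors that have norm
    one in the chart. This ratio is the same for all the metrics of the
    structure, being unchanged by scaling. *)
Definition round_at c p (A : R) := exists g, [/\ metrics S g, gdom g p &
  forall v w, gram_form (gmx g c p) v * `|w| ^+ 2 <=
    A ^+ 2 * (`|v| ^+ 2 * gram_form (gmx g c p) w)].

Lemma round_at_metric c p A g : atlas c -> cdom c p -> metrics S g -> gdom g p ->
  round_at c p A -> forall v w, gram_form (gmx g c p) v * `|w| ^+ 2 <=
    A ^+ 2 * (`|v| ^+ 2 * gram_form (gmx g c p) w).
Proof.
move=> Ac cp Sg gp [h [Sh hp hA]] v w.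
have [f [_ f0 fE]] := metrics_conformal Sh Sg.
rewrite (fE c p Ac cp hp gp) !gram_formZ.
have := hA v w; rewrite -(ler_pM2l (f0 p hp gp)); lra.
Qed.

Lemma gram_near c g p : atlas c -> cdom c p -> gdom g p ->
  exists m B r, [/\ 0 < m, 0 < B, 0 < r & forall y, `|y - cmap c p| < r ->
    [/\ crange c y, gdom g (cinv c y) & forall v,
      m * `|v| ^+ 2 <= gram_form (gmx g c (cinv c y)) v <= B * `|v| ^+ 2]].
Proof.
move=> Ac cp gp; pose G0 := gmx g c p.
have [m m0 hm] : exists2 m, 0 < m & forall v, m * `|v| ^+ 2 <= gram_form G0 v.
  by apply: gram_form_pos => v v0; exact: gmx_pos.
have K0 : 0 < n%:R ^+ 2 + 1 :> R by rewrite ltr_wpDl// exprn_ge0.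
pose e := m / 2 / (n%:R ^+ 2 + 1); have e0 : 0 < e by rewrite !divr_gt0.
have Up : (cmap c @` (cdom c `&` gdom g)) (cmap c p) by exists p.
have [cG _] := gmx_smooth g Ac 0%N.
have /cvgrPdist_le/(_ e e0)/nbhs_ballP[r1 /= r10 h1] := cG _ Up.
have nV : nbhs (cinv c (cmap c p)) (gdom g).
  by rewrite cmapK//; apply: open_nbhs_nbhs; split => //; exact: gdom_open.
have [r2 r20 h2] := cinv_nbhs (cmap_sub cp) nV.
exists (m / 2), (n%:R ^+ 2 * `|G0| + m), (Num.min r1 r2); split.
- by rewrite divr_gt0.
- by rewrite ltr_wpDl// mulr_ge0// exprn_ge0.
- by rewrite lt_min r10 r20.
move=> y; rewrite lt_min => /andP[y1 y2]; have [cy gy] := h2 y y2; split => // v.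
have := h1 y; rewrite -ball_normE/= distrC cmapK// => /(_ y1) hG.
have := gram_form_le (G0 - gmx g c (cinv c y)) v; rewrite gram_formB.
have hE : n%:R ^+ 2 * `|G0 - gmx g c (cinv c y)| * `|v| ^+ 2 <= m / 2 * `|v| ^+ 2.
  rewrite ler_wpM2r ?exprn_ge0//.
  apply: (@le_trans _ _ ((n%:R ^+ 2 + 1) * e)).
    by apply: ler_pM => //; rewrite ?exprn_ge0// lerDl.
  by rewrite /e [leLHS]mulrC divfK// gt_eqF.
have h3 := hm v; have := gram_form_le G0 v; rewrite !ler_norml.
move=> /andP[h4 h5] /andP[h6 h7].
by rewrite !mulrDl; apply/andP; split; lra.
Qed.

Lemma round_near c p : atlas c -> cdom c p -> exists A r, [/\ 0 < A, 0 < r &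
  forall y, `|y - cmap c p| < r -> crange c y /\ round_at c (cinv c y) A].
Proof.
move=> Ac cp.
have [g Sg gp] : exists2 g, metrics S g & gdom g p.
  by have : [set: M] p by []; rewrite -(metrics_cover S) => -[g]; exists g.
have [m [B [r [m0 B0 r0 h]]]] := gram_near Ac cp gp.
have A1 : 0 < B / m by rewrite divr_gt0.
exists (B / m + 1), r; split => //; first lra.
move=> y /h[cy gy hv]; split => //; exists g; split => // v w.
have /andP[_ hv2] := hv v; have /andP[hw1 _] := hv w.
have v0 : 0 <= `|v| ^+ 2 by rewrite exprn_ge0.
have w0 : 0 <= `|w| ^+ 2 by rewrite exprn_ge0.
apply: (@le_trans _ _ ((B / m) * (`|v| ^+ 2 * (m * `|w| ^+ 2)))).
  have -> : B / m * (`|v| ^+ 2 * (m * `|w| ^+ 2)) = B * `|v| ^+ 2 * `|w| ^+ 2.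
    by field; rewrite gt_eqF.
  by rewrite ler_wpM2r.
apply: ler_pM.
- exact: ltW.
- by rewrite !mulr_ge0// ltW.
- by rewrite expr2; nra.
- by rewrite ler_wpM2l.
Qed.

Lemma mx_norm_attained (J : 'M[R]_n) : J != 0 -> exists2 v : 'rV[R]_n, `|v| = 1 & `|J| <= `|v *m J|.
Proof.
move=> J0; have [[i j] Jij] : exists ij, `|J| = `|J ij.1 ij.2|.
  by apply: mx_norm_neq0; apply: contra_neq J0 => /mx_norm_eq0.
exists (delta_mx 0 i).
  apply/eqP; rewrite eq_le; apply/andP; split.
    apply: row_norm_le => // l; rewrite mxE /=.
    by case: (l == i); rewrite ?normr1 ?normr0.
  have := row_coord_le (delta_mx 0 i : 'rV[R]_n) i.
  by rewrite mxE !eqxx normr1.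
by rewrite Jij -rowE; have := row_coord_le (row i J) j; rewrite mxE.
Qed.

Lemma jacobian_neq0 c d p g : (0 < n)%N -> atlas c -> atlas d -> cdom c p -> cdom d p ->
  gdom g p -> 'J (transition c d) (cmap c p) != 0.
Proof.
move=> n0 Ac Ad cp dp gp; apply/eqP => J0.
pose v : 'rV[R]_n := const_mx 1.
have v0 : v != 0.
  apply/eqP => /rowP/(_ (Ordinal n0)); rewrite !mxE => /eqP; by rewrite oner_eq0.
have := gmx_pos Ac cp gp v0; rewrite (gmx_change Ac Ad cp dp gp) J0.
by rewrite !mul0mx mulmx0 mul0mx mxE ltxx.
Qed.

Lemma le_sqr (a b : R) : 0 <= a -> a <= b -> a ^+ 2 <= b ^+ 2.
Proof. by move=> a0 ab; rewrite ler_pXn2r ?nnegrE// (le_trans a0). Qed.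

Lemma distortion_arith (m B A j j' jw Gv Gw : R) : 0 < m -> 0 < B -> 0 < A ->
  0 <= j -> 0 <= j' -> j' <= jw -> m * j ^+ 2 <= Gv -> Gw <= B ->
  Gv * jw ^+ 2 <= A ^+ 2 * Gw -> j * j' <= A * (B / m + 1).
Proof.
move=> m0 B0 A0 j0 j'0 jj hv hw h.
have h1 : m * j ^+ 2 * j' ^+ 2 <= A ^+ 2 * B.
  apply: (@le_trans _ _ (Gv * jw ^+ 2)).
    apply: ler_pM => //; last by rewrite ler_pXn2r ?nnegrE// (le_trans j'0).
      by rewrite mulr_ge0 ?exprn_ge0// ltW.
    by rewrite exprn_ge0.
  by apply: (le_trans h); rewrite ler_wpM2l ?exprn_ge0// ltW.
have Bm : 0 < B / m by rewrite divr_gt0.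
have h0 : 0 <= A * (B / m + 1) by rewrite mulr_ge0 ?(ltW A0)//; lra.
rewrite -(@ler_pXn2r _ 2)// ?nnegrE ?mulr_ge0//.
rewrite !exprMn -(ler_pM2l m0) mulrA; apply: (le_trans h1).
rewrite mulrCA ler_wpM2l ?exprn_ge0 ?(ltW A0)//.
have Bq : B = m * (B / m) by rewrite mulrC divfK// gt_eqF.
rewrite {1}Bq; set q := B / m in Bm *.
by rewrite ler_wpM2l ?(ltW m0)// expr2; nra.
Qed.

(** The forms of the metric in [c] (by [A]) and in [d] (by [m] and [B]) are both
    pinched, and the transition carries one to the other, so it distorts all
    directions by about the same factor: its norm times the norm of its inverse
    is bounded. The bound is linear in [A]; this exponent has to match the
    weight [A ^+ n] of the energy. *)
Lemma round_distortion c d p g A m B : (0 < n)%N -> atlas c -> atlas d ->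
  cdom c p -> cdom d p -> metrics S g -> gdom g p -> 0 < m -> 0 < B -> 0 < A ->
  (forall v, m * `|v| ^+ 2 <= gram_form (gmx g d p) v <= B * `|v| ^+ 2) ->
  round_at c p A ->
  `|'J (transition c d) (cmap c p)| * `|'J (transition d c) (cmap d p)| <= A * (B / m + 1).
Proof.
move=> n0 Ac Ad cp dp Sg gp m0 B0 A0 hmB rA.
set J := 'J _ _; set J' := 'J _ _.
have [v v1 Jv] := mx_norm_attained (jacobian_neq0 n0 Ac Ad cp dp gp).
have [w w1 Jw] := mx_norm_attained (jacobian_neq0 n0 Ad Ac dp cp gp).
rewrite -/J in Jv; rewrite -/J' in Jw.
have := round_at_metric Ac cp Sg gp rA v (w *m J').
have Gv : m * `|J| ^+ 2 <= gram_form (gmx g c p) v.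
  rewrite (gmx_change Ac Ad cp dp gp) gram_form_congr -/J.
  have /andP[+ _] := hmB (v *m J); apply: le_trans; rewrite ler_wpM2l ?(ltW m0)//.
  exact: (le_sqr (normr_ge0 J) Jv).
have Gw : gram_form (gmx g c p) (w *m J') <= B.
  rewrite -gram_form_congr -(gmx_change Ad Ac dp cp gp).
  by have /andP[_] := hmB w; rewrite w1 expr1n mulr1.
rewrite v1 expr1n mul1r => h.
exact: (distortion_arith m0 B0 A0 (normr_ge0 J) (normr_ge0 J') Jw Gv Gw h).
Qed.

(** The cube of half-side [s] at [z] in the chart [c] is seen from the chart [d]:
    [rho] is the half-side of a cube inside its image, and the image of its
    threefold dilate has size comparable to [rho]. *)
Definition cell_image c d p (eps K A : R) z (s rho : R) :=
  [/\ 0 < rho, rho <= eps,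
     forall w, `|w - transition c d z| < rho ->
       `|w - cmap d p| < eps /\ `|transition d c w - z| < s &
     forall y y', `|y - z| < 3 * s -> `|y' - z| < 3 * s ->
       `|transition c d y' - transition c d y| <= A * K * rho].

Definition carries_cells c d p (eps K r : R) :=
  (forall y, `|y - cmap c p| < r ->
     [/\ crange c y, cdom d (cinv c y) & `|transition c d y - cmap d p| < eps]) /\
  forall A z s, 0 < A -> round_at c p A -> 0 < s -> `|z - cmap c p| + 3 * s <= r ->
    exists rho, cell_image c d p eps K A z s rho.

(** Near [p] both transitions are Lipschitz with constants [L] and [L'] comparable
    to the norms of their differentials. The radius [s / L'] makes the inner cube
    fit, and the image of the dilate has size at most [6 * L * s], so that the
    quotient is governed by [L * L'], that is by [round_distortion]. *)
Lemma packing_cell c d p g m B eps : (0 < n)%N -> atlas c -> atlas d ->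
  cdom c p -> cdom d p -> metrics S g -> gdom g p -> 0 < m -> 0 < B -> 0 < eps ->
  (forall v, m * `|v| ^+ 2 <= gram_form (gmx g d p) v <= B * `|v| ^+ 2) ->
  exists2 r, 0 < r & carries_cells c d p eps (6 * n.+1%:R ^+ 2 * (B / m + 1)) r.
Proof.
move=> n0 Ac Ad cp dp Sg gp m0 B0 eps0 hmB.
set a := cmap c p; set b := cmap d p.
set phi := transition c d; set psi := transition d c.
have phia : phi a = b by rewrite /phi /transition/= cmapK.
set J := 'J phi a; set J' := 'J psi b.
have J0 : J != 0 := jacobian_neq0 n0 Ac Ad cp dp gp.
have J'0 : J' != 0 := jacobian_neq0 n0 Ad Ac dp cp gp.
have [r1 r10 lip] := transition_lipschitz Ac Ad cp dp J0.
have [r2 r20 lip'] := transition_lipschitz Ad Ac dp cp J'0.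
rewrite -/a -/phi -/J in lip; rewrite -/b -/psi -/J' in lip'.
have dist A : 0 < A -> round_at c p A -> `|J| * `|J'| <= A * (B / m + 1).
  by move=> A0 rA; exact: (round_distortion n0 Ac Ad cp dp Sg gp m0 B0 A0 hmB rA).
clearbody J J'.
pose L := n.+1%:R * `|J|; pose L' := n.+1%:R * `|J'|.
have L0 : 0 < L by rewrite mulr_gt0// normr_gt0.
have L'0 : 0 < L' by rewrite mulr_gt0// normr_gt0.
have nd : nbhs (cinv c a) (cdom d).
  by rewrite cmapK//; apply: open_nbhs_nbhs; split => //; exact: cdom_open.
have [r3 r30 hr3] := cinv_nbhs (cmap_sub cp) nd.
pose e := Num.min r2 eps / 2.
have e0 : 0 < e by rewrite divr_gt0// lt_min r20 eps0.
have [e1 e2] : 2 * e <= r2 /\ 2 * e <= eps.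
  by rewrite /e mulrC divfK// !ge_min !lexx orbT.
pose r := Num.min (Num.min r1 r3) (Num.min (e / L) (e * L')).
have r0 : 0 < r by rewrite !lt_min r10 r30 divr_gt0// mulr_gt0.
have [rr1 rr3 rr4 rr5] : [/\ r <= r1, r <= r3, r <= e / L & r <= e * L'].
  by split; rewrite /r !ge_min lexx ?orbT.
have phi_near y : `|y - a| < r -> `|phi y - b| < e.
  move=> ya; rewrite -phia; apply: (le_lt_trans (lip a y _ _)).
  - by rewrite subrr normr0.
  - exact: lt_le_trans ya rr1.
  - by rewrite -/L mulrC -ltr_pdivlMr//; exact: lt_le_trans ya rr4.
exists r => //; split=> [y ya|A z s A0 rA s0 zs].
  have [cy dy] := hr3 y (lt_le_trans ya rr3); split => //.
  by apply: lt_le_trans (phi_near y ya) _; lra.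
have za : `|z - a| < r by lra.
have [cz dz] := hr3 z (lt_le_trans za rr3).
have ball_r y : `|y - z| < 3 * s -> `|y - a| < r1.
  move=> yz; apply: lt_le_trans rr1; have -> : y - a = (y - z) + (z - a) by rewrite addrA subrK.
  by apply: (le_lt_trans (ler_normD _ _)); lra.
have sL : s / L' <= e by rewrite ler_pdivrMr//; have := normr_ge0 (z - a); lra.
exists (s / L'); split; [by rewrite divr_gt0|by lra| |].
- move=> w wz.
  have wb : `|w - b| < 2 * e.
    have -> : w - b = (w - phi z) + (phi z - b) by rewrite addrA subrK.
    by apply: (le_lt_trans (ler_normD _ _)); have := phi_near z za; lra.
  split; first by lra.
  have -> : z = psi (phi z) by rewrite /psi /phi /transition/= cmapK// cinvK.
  apply: (le_lt_trans (lip' _ _ _ _)).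
  + by have := phi_near z za; lra.
  + by lra.
  + by rewrite -/L' mulrC -ltr_pdivlMr.
- move=> y y' yz y'z.
  apply: (le_trans (lip _ _ (ball_r _ yz) (ball_r _ y'z))); rewrite -/L.
  have yy : `|y' - y| <= 6 * s.
    have -> : y' - y = (y' - z) - (y - z) by rewrite opprB addrA subrK.
    by apply: (le_trans (ler_normB _ _)); lra.
  apply: (@le_trans _ _ (L * (6 * s))); first by rewrite ler_wpM2l// ltW.
  have -> : L * (6 * s) = 6 * n.+1%:R ^+ 2 * (`|J| * `|J'|) * (s / L').
    have nJ' : `|J'| != 0 by rewrite normr_eq0.
    have nn : n.+1%:R != 0 :> R by rewrite pnatr_eq0.
    by rewrite /L /L'; field; rewrite nJ' nat1r nn.
  rewrite ler_wpM2r ?divr_ge0 ?(ltW L'0) ?(ltW s0)//.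
  rewrite [leRHS]mulrCA ler_wpM2l ?mulr_ge0//.
  exact: dist.
Qed.

End ConformalGeometry.

(** * Logarithmic bump functions *)

Section Ramp.
Variable R : realType.
Implicit Types r t : R.

Definition ramp r t := Num.max 0 (Num.min 1 (2 - t / r)).

Lemma ramp1 r t : 0 < r -> t <= r -> ramp r t = 1.
Proof.
move=> r0 tr; have : t / r <= 1 by rewrite ler_pdivrMr// mul1r.
by move=> h; rewrite /ramp (min_idPl _) ?(max_idPr _)//; lra.
Qed.

Lemma ramp0 r t : 0 < r -> 2 * r <= t -> ramp r t = 0.
Proof.
move=> r0 tr; have h : 2 <= t / r by rewrite ler_pdivlMr.
by rewrite /ramp (max_idPl _)// ge_min; apply/orP; right; lra.
Qed.

Lemma max_dist (a b a' b' e : R) : `|a - a'| <= e -> `|b - b'| <= e ->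
  `|Num.max a b - Num.max a' b'| <= e.
Proof.
rewrite !ler_distl => /andP[a1 a2] /andP[b1 b2]; rewrite lerBlDr !ge_max.
have m1 : a' <= Num.max a' b' by rewrite le_max lexx.
have m2 : b' <= Num.max a' b' by rewrite le_max lexx orbT.
have m3 : a <= Num.max a b by rewrite le_max lexx.
have m4 : b <= Num.max a b by rewrite le_max lexx orbT.
move: m1 m2 m3 m4; set m := Num.max a b; set m' := Num.max a' b' => m1 m2 m3 m4.
by apply/and3P; split; [apply/andP; split|..]; lra.
Qed.

Lemma min_dist (a b a' b' e : R) : `|a - a'| <= e -> `|b - b'| <= e ->
  `|Num.min a b - Num.min a' b'| <= e.
Proof.
move=> ha hb; rewrite -[Num.min a b]opprK -[Num.min a' b']opprK !oppr_min -opprD normrN.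
by apply: max_dist; rewrite -opprD normrN.
Qed.

Lemma ramp_lip r t t' : 0 < r -> `|ramp r t - ramp r t'| <= `|t - t'| / r.
Proof.
move=> r0; have e0 : 0 <= `|t - t'| / r by rewrite divr_ge0// ltW.
apply: max_dist; first by rewrite subrr normr0.
apply: min_dist; first by rewrite subrr normr0.
have -> : 2 - t / r - (2 - t' / r) = - ((t - t') / r) by ring.
by rewrite normrN normrM normfV (gtr0_norm r0).
Qed.
End Ramp.

Section LogBump.
Variables (R : realType) (n : nat) (a : 'rV[R]_n) (R0 : R) (L : nat).
Hypotheses (n1 : (1 < n)%N) (R00 : 0 < R0) (L0 : (0 < L)%N).

Definition bump_radius (k : nat) : R := R0 / 2 / 4 ^+ k.

Lemma bump_radius_gt0 k : 0 < bump_radius k.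
Proof. by rewrite !divr_gt0// exprn_gt0. Qed.

Lemma bump_radiusS k l : (k < l)%N -> 4 * bump_radius l <= bump_radius k.
Proof.
move=> kl; have h : 4 * 4 ^+ k <= 4 ^+ l :> R by rewrite -exprS ler_weXn2l// ler1n.
have q0 : 0 <= R0 / 2 by rewrite divr_ge0// ltW.
have [p1 p2] : 0 < 4 ^+ k :> R /\ 0 < 4 ^+ l :> R by rewrite !exprn_gt0.
rewrite /bump_radius; move: h q0 p1 p2; move: (4 ^+ k) (4 ^+ l) (R0 / 2) => x y q h q0 x0 y0.
rewrite ler_pdivlMr// (_ : 4 * (q / y) * x = q * (4 * x / y)); last by ring.
by rewrite ler_piMr// ler_pdivrMr// mul1r.
Qed.

Lemma bump_radius_last (k : 'I_L) : bump_radius L.-1 <= bump_radius k.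
Proof.
have [->//|kL] := eqVneq (k : nat) L.-1.
have : (k < L.-1)%N by rewrite ltn_neqAle kL -ltnS (prednK L0) ltn_ord.
by move/bump_radiusS; have := bump_radius_gt0 L.-1; move=> h1 h2; lra.
Qed.

(** The average of [L] ramps, whose slopes live in the disjoint shells between
    [bump_radius k] and [2 * bump_radius k]; up to scale, a truncated logarithm
    of the distance to [a]. *)
Definition bump (w : 'rV[R]_n) := L%:R^-1 * \sum_(k < L) ramp (bump_radius k) `|w - a|.

Lemma bump1 w : `|w - a| <= bump_radius L.-1 -> bump w = 1.
Proof.
move=> wa; rewrite /bump (eq_bigr (fun=> 1)).
  by rewrite sumr_const card_ord mulVf// pnatr_eq0 -lt0n.
move=> k _; apply: ramp1; first exact: bump_radius_gt0.
exact: le_trans wa (bump_radius_last k).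
Qed.

Lemma bump0 w : R0 <= `|w - a| -> bump w = 0.
Proof.
move=> wa; rewrite /bump big1 ?mulr0// => k _; apply: ramp0; first exact: bump_radius_gt0.
apply: le_trans wa; have h : bump_radius k <= bump_radius 0.
  have [->//|k0] := eqVneq (k : nat) 0%N.
  have : (0 < k)%N by rewrite lt0n.
  by move/bump_radiusS; have := bump_radius_gt0 k; lra.
by move: h; rewrite /bump_radius expr0 divr1; lra.
Qed.

Lemma expr_sum_single (f : 'I_L -> R) :
  (forall k l, f k != 0 -> f l != 0 -> k = l) ->
  (\sum_k f k) ^+ n = \sum_k f k ^+ n.
Proof.
move=> f1; have n0 : (0 < n)%N by exact: ltnW.
have [k fk|f0] := pickP (fun k => f k != 0).
  have fl l : l != k -> f l = 0.
    by move=> lk; apply/eqP; apply: contraNT lk => fl; apply/eqP; exact: f1.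
  rewrite (bigD1 k)//= [RHS](bigD1 k)//= !big1 ?addr0// => l /fl->//.
  by rewrite expr0n gtn_eqF.
have fl l : f l = 0 by apply/eqP; have := f0 l => /negbFE.
by rewrite !big1 ?expr0n ?gtn_eqF// => l _; rewrite fl expr0n gtn_eqF.
Qed.

Variable eps : R.
Hypothesis epsL : 2 * eps <= bump_radius L.-1.

Let diff k (w w' : 'rV[R]_n) : R :=
  `|ramp (bump_radius k) `|w - a| - ramp (bump_radius k) `|w' - a| |.

Lemma diff_range k w w' : diff k w w' != 0 ->
  (`|w - a| < 2 * bump_radius k \/ `|w' - a| < 2 * bump_radius k) /\
  (bump_radius k < `|w - a| \/ bump_radius k < `|w' - a|).
Proof.
have r0 := bump_radius_gt0 k; move=> d0; split.
  have [|h1] := ltP (`|w - a|) (2 * bump_radius k); first by left.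
  have [|h2] := ltP (`|w' - a|) (2 * bump_radius k); first by right.
  by move: d0; rewrite /diff !ramp0// subrr normr0 eqxx.
have [|h1] := ltP (bump_radius k) (`|w - a|); first by left.
have [|h2] := ltP (bump_radius k) (`|w' - a|); first by right.
by move: d0; rewrite /diff !ramp1// subrr normr0 eqxx.
Qed.

(** The shell of [rl] ends at [2 * rl] and the next one starts at
    [4 * rl] or later; the gap exceeds [2 * e], so that a pair of points closer than this cannot
    feel the slopes of two different ramps. *)
Lemma shell_separation (x x' e rk rl rL : R) : `|x - x'| < 2 * e -> 2 * e <= rL ->
  rL <= rl -> 0 < rl -> 4 * rl <= rk -> (rk < x \/ rk < x') ->
  (x < 2 * rl \/ x' < 2 * rl) -> False.
Proof.
rewrite ltr_norml => /andP[t1 t2] eL Ll l0 lk.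
by case=> hk; case=> hl; lra.
Qed.

Lemma shell_radius (x r rho e : R) : 0 < r -> x < 2 * r + 2 * e -> rho <= e -> 2 * e <= r ->
  x + rho <= 4 * r.
Proof. lra. Qed.

Lemma bump_diff_expr w w' : `|w - w'| < 2 * eps ->
  `|bump w - bump w'| ^+ n <= L%:R^-1 ^+ n * \sum_(k < L) diff k w w' ^+ n.
Proof.
move=> ww; rewrite -expr_sum_single.
  rewrite -exprMn; apply: lerXn2r; rewrite ?nnegrE//.
    by rewrite mulr_ge0 ?invr_ge0// sumr_ge0// => k _; exact: normr_ge0.
  rewrite /bump -mulrBr -sumrB normrM normfV normr_nat.
  by rewrite ler_wpM2l ?invr_ge0//; exact: ler_norm_sum.
have tt : `| `|w - a| - `|w' - a| | < 2 * eps.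
  by apply: le_lt_trans (ler_dist_dist _ _) _; rewrite opprB addrA subrK.
move=> k l; wlog kl : k l / (k <= l)%N.
  by move=> wl h1 h2; have [kl|/ltnW lk] := leqP k l; [exact: wl|apply/esym/wl].
move=> /diff_range[_ hk] /diff_range[hl _]; apply: val_inj => /=.
have [//|kl'] := eqVneq (k : nat) l.
have klt : (k < l)%N by rewrite ltn_neqAle kl'.
have h1 := bump_radiusS klt.
have h2 := bump_radius_last l.
have h3 := bump_radius_gt0 l.
by case: (shell_separation tt epsL h2 (bump_radius_gt0 l) h1 hk hl).
Qed.

(** Conformal invariance in the flat case: a ramp of radius [r] has slope
    [1 / r] on a shell of volume of order [r ^+ n], so each of the [L] shells
    contributes a bounded energy, and the factor [1 / L] of the average, raised
    to the power [n], beats the number [L] of shells. *)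
Lemma bump_packing (I : finType) (P : {pred I}) (w w' zeta b : I -> 'rV[R]_n)
    (rho : I -> R) (K : R) : 0 < eps -> 0 <= K ->
  {in P, forall i, [/\ 0 < rho i, rho i <= eps & `|w i - w' i| <= K * rho i]} ->
  {in P, forall i, [/\ `|w i - b i| < eps, `|w' i - b i| < eps & `|zeta i - b i| < eps]} ->
  {in P &, forall i j, forall y, i != j ->
    `|y - zeta i| < rho i -> `|y - zeta j| < rho j -> False} ->
  \sum_(i in P) `|bump (w i) - bump (w' i)| ^+ n <= (8 * K) ^+ n / L%:R.
Proof.
move=> eps0 K0 hrho hb disj.
have Lr : 0 < L%:R :> R by rewrite ltr0n.
have n0 : (0 < n)%N by exact: ltnW.
have ww i : i \in P -> `|w i - w' i| < 2 * eps.
  move=> iP; have [h1 h2 _] := hb i iP.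
  rewrite (_ : w i - w' i = (w i - b i) - (w' i - b i)); last by rewrite opprB addrA subrK.
  by apply: (le_lt_trans (ler_normB _ _)); lra.
apply: (@le_trans _ _ (\sum_(i in P) L%:R^-1 ^+ n * \sum_(k < L) diff k (w i) (w' i) ^+ n)).
  by apply: ler_sum => i iP; apply: bump_diff_expr; exact: ww.
rewrite -mulr_sumr exchange_big/=.
have shell (k : 'I_L) : \sum_(i in P) diff k (w i) (w' i) ^+ n <= (8 * K) ^+ n.
  have r0 := bump_radius_gt0 k.
  have rk := le_trans epsL (bump_radius_last k).
  pose Q := [pred i | (i \in P) && (diff k (w i) (w' i) != 0)].
  rewrite (bigID (fun i => diff k (w i) (w' i) != 0))/= [X in _ + X]big1 ?addr0; last first.
    by move=> i /andP[_ /negbNE/eqP->]; rewrite expr0n gtn_eqF.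
  apply: (@le_trans _ _ (\sum_(i in Q) (K / bump_radius k) ^+ n * rho i ^+ n)).
    rewrite (eq_bigl (mem Q)); last by move=> i; rewrite inE.
    apply: ler_sum => i; rewrite inE => /andP[iP _]; rewrite -exprMn.
    have [rho0 _ wk] := hrho i iP.
    apply: lerXn2r; rewrite ?nnegrE ?normr_ge0//.
      by rewrite mulr_ge0 ?divr_ge0// ltW.
    apply: (le_trans (ramp_lip _ _ r0)).
    rewrite mulrAC; apply: ler_wpM2r; first by rewrite invr_ge0 ltW.
    apply: le_trans wk.
    by apply: le_trans (ler_dist_dist _ _) _; rewrite opprB addrA subrK.
  rewrite -mulr_sumr.
  have vol : \sum_(i in Q) rho i ^+ n <= (2 * (4 * bump_radius k)) ^+ n.
    apply: (@disjoint_cubes_volume_cond R n I Q zeta rho a).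
    - by rewrite mulr_gt0.
    - by move=> i; rewrite inE => /andP[/hrho[]].
    - move=> i; rewrite inE => /andP[iP /diff_range[h _]].
      have [_ rhoe _] := hrho i iP; have [h1 h2 h3] := hb i iP.
      have key v : `|v - b i| < eps -> `|v - a| < 2 * bump_radius k ->
          `|zeta i - a| < 2 * bump_radius k + 2 * eps.
        move=> vb va; have -> : zeta i - a = (zeta i - b i) - (v - b i) + (v - a).
          by rewrite opprB !addrA !subrK.
        apply: (le_lt_trans (ler_normD _ _)); have := ler_normB (zeta i - b i) (v - b i).
        by move: h3 vb va; clear; lra.
      have zk : `|zeta i - a| < 2 * bump_radius k + 2 * eps.
        by case: h => h; [exact: key h1 h|exact: key h2 h].
      exact: shell_radius r0 zk rhoe rk.
    - by move=> i j; rewrite !inE => /andP[iP _] /andP[jP _]; exact: disj.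
  apply: (@le_trans _ _ ((K / bump_radius k) ^+ n * (2 * (4 * bump_radius k)) ^+ n)).
    by rewrite ler_wpM2l// exprn_ge0// divr_ge0// ltW.
  rewrite -exprMn le_eqVlt; apply/orP; left; apply/eqP; congr (_ ^+ n).
  by field; rewrite gt_eqF.
apply: (@le_trans _ _ (L%:R^-1 ^+ n * \sum_(k < L) (8 * K) ^+ n)).
  by rewrite ler_wpM2l ?exprn_ge0 ?invr_ge0//; apply: ler_sum => k _; exact: shell.
rewrite sumr_const card_ord -[(8 * K) ^+ n *+ L]mulr_natl [leRHS]mulrC mulrA.
rewrite ler_wpM2r ?exprn_ge0 ?mulr_ge0//.
have -> : n = n.-2.+2 by lia.
rewrite exprSr -mulrA mulVf ?gt_eqF// mulr1 exprS ler_piMr ?invr_ge0 ?(ltW Lr)//.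
by rewrite exprn_ile1 ?invr_ge0 ?(ltW Lr)// invf_le1// ler1n.
Qed.

End LogBump.

(** * The conformal energy and the capacity of a point *)

Section Energy.
Variables (R : realType) (n : nat) (M : manifold R n) (S : conformal_structure M).
Implicit Types (c d : chart R n M) (p : M) (u : M -> R).
Implicit Types (delta : chart R n M -> M -> R).

Definition gauge delta := forall c p, 0 < delta c p.

(** Finite packings of chart cubes by disjoint cubes of half-side [s i] around
    [z i], each within the gauge of a point [p i] where the chart is [A]-round.
    The values of [u] are compared on the threefold dilate, which reaches the
    neighbouring cubes of a grid. *)
Definition energy_le u delta (e : R) := forall c, atlas c -> forall (A : R), 0 < A ->
  forall (I : finType) (p : I -> M) (z : I -> 'rV[R]_n) (s : I -> R) (y y' : I -> 'rV[R]_n),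
  (forall i, [/\ cdom c (p i), round_at S c (p i) A, 0 < s i &
     `|z i - cmap c (p i)| + 3 * s i <= delta c (p i)]) ->
  (forall i, `|y i - z i| < 3 * s i /\ `|y' i - z i| < 3 * s i) ->
  (forall i j w, i != j -> `|w - z i| < s i -> `|w - z j| < s j -> False) ->
  \sum_i `|u (cinv c (y i)) - u (cinv c (y' i))| ^+ n <= A ^+ n * e.

Lemma energy_le_mono u delta e f : e <= f -> energy_le u delta e -> energy_le u delta f.
Proof.
move=> ef h c Ac A A0 I p z s y y' h1 h2 h3; apply: (le_trans (h c Ac A A0 I p z s y y' h1 h2 h3)).
by rewrite ler_wpM2l// exprn_ge0// ltW.
Qed.

Lemma maxr_dist_expr (a b a' b' : R) :
  `|Num.max a b - Num.max a' b'| ^+ n <= `|a - a'| ^+ n + `|b - b'| ^+ n.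
Proof.
have : `|Num.max a b - Num.max a' b'| <= Num.max `|a - a'| `|b - b'|.
  by apply: max_dist; rewrite le_max lexx ?orbT.
case: (leP `|a - a'| `|b - b'|) => _ h.
  by rewrite -[leLHS]add0r; apply: lerD; rewrite ?exprn_ge0//; apply: lerXn2r; rewrite ?nnegrE.
by rewrite -[leLHS]addr0; apply: lerD; rewrite ?exprn_ge0//; apply: lerXn2r; rewrite ?nnegrE.
Qed.

Lemma energy_le_max u v delta delta' e f : energy_le u delta e -> energy_le v delta' f ->
  energy_le (fun p => Num.max (u p) (v p)) (fun c p => Num.min (delta c p) (delta' c p)) (e + f).
Proof.
move=> hu hv c Ac A A0 I p z s y y' h1 h2 h3.
rewrite mulrDr; apply: (@le_trans _ _ (\sum_i (`|u (cinv c (y i)) - u (cinv c (y' i))| ^+ n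
   + `|v (cinv c (y i)) - v (cinv c (y' i))| ^+ n))).
  by apply: ler_sum => i _; exact: maxr_dist_expr.
rewrite big_split/=; apply: lerD.
  apply: (hu c Ac A A0 I p z s) => // i; have [cp rp s0] := h1 i.
  by rewrite le_min => /andP[].
apply: (hv c Ac A A0 I p z s) => // i; have [cp rp s0] := h1 i.
by rewrite le_min => /andP[].
Qed.

(** A gauge for a bump supported in the cube of half-side [R0] of the chart [c0]:
    a cell within the gauge either misses the support, which is closed, or lies
    in the domain of [c0] with a bounded distortion. *)
Lemma bump_chart_gauge c0 x g m B r R0 eps : (0 < n)%N -> atlas c0 -> cdom c0 x ->
  metrics S g -> 0 < m -> 0 < B -> 0 < eps -> R0 < r ->
  (forall y, `|y - cmap c0 x| < r -> [/\ crange c0 y, gdom g (cinv c0 y) & forall v,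
      m * `|v| ^+ 2 <= gram_form (gmx g c0 (cinv c0 y)) v <= B * `|v| ^+ 2]) ->
  exists2 delta, gauge delta & forall c p, atlas c -> cdom c p ->
    ((forall y, `|y - cmap c p| < delta c p ->
       ~ (cdom c0 (cinv c y) /\ `|cmap c0 (cinv c y) - cmap c0 x| <= R0)) \/
     carries_cells S c c0 p eps (6 * n.+1%:R ^+ 2 * (B / m + 1)) (delta c p)).
Proof.
move=> n0 Ac0 c0x Sg m0 B0 eps0 R0r hg; set a := cmap c0 x.
pose K := [set p : M | cdom c0 p /\ `|cmap c0 p - a| <= R0].
have Kc : closed K.
  apply: chart_closed_cube; first exact: carrier_hausdorff.
  by move=> y yR; have [] := hg y (le_lt_trans yR R0r).
suff H (cp : chart R n M * M) : exists r, 0 < r /\ (atlas cp.1 -> cdom cp.1 cp.2 ->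
    ((forall y, `|y - cmap cp.1 cp.2| < r -> ~ K (cinv cp.1 y)) \/
     carries_cells S cp.1 c0 cp.2 eps (6 * n.+1%:R ^+ 2 * (B / m + 1)) r)).
  have [f hf] := choice H.
  exists (fun c p => f (c, p)) => [c p|c p Ac cp]; first by have [] := hf (c, p).
  by have [_] := hf (c, p); exact.
case: cp => c p /=.
have [[Ac cp]|nAc] := pselect (atlas c /\ cdom c p); last by exists 1; split => // ? ?; case: nAc.
have [Kp|nKp] := pselect (K p); last first.
  have nb : nbhs (cinv c (cmap c p)) (~` K).
    by rewrite cmapK//; apply: open_nbhs_nbhs; split => //; exact: closed_openC.
  have [r1 r10 h1] := cinv_nbhs (cmap_sub cp) nb.
  by exists r1; split => // _ _; left => y /h1[].
have [c0p pR] := Kp.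
have [_] := hg (cmap c0 p) (le_lt_trans pR R0r); rewrite cmapK// => gp hv.
have [r1 r10 h1] := packing_cell n0 Ac Ac0 cp c0p Sg gp m0 B0 eps0 hv.
by exists r1; split => // _ _; right.
Qed.

(** A logarithmic bump around [x]. The number of shells is chosen so that
    [bump_packing], whose constant [K] is the distortion from [packing_cell] for
    round charts, gives an energy at most [e]. Seen in [c0], a packing in any
    chart contains disjoint cubes of comparable size, to which [bump_packing]
    applies with the constant [A * K]. *)
Lemma small_capacity x (U : set M) e : (1 < n)%N -> nbhs x U -> 0 < e ->
  exists u delta V, [/\ gauge delta, energy_le u delta e, nbhs x V,
    forall y, V y -> exists C : set M, [/\ connected C, C x, C y & forall p, C p -> 1 <= u p] &
    forall p, u p != 0 -> U p].
Proof.
move=> n1 xU e0; have n0 : (0 < n)%N by exact: ltnW.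
have [c0 Ac0 c0x] : exists2 c, atlas c & cdom c x.
  by have : [set: M] x by []; rewrite -(atlas_maximal M).1.1 => -[c]; exists c.
have [g Sg gx] : exists2 g, metrics S g & gdom g x.
  by have : [set: M] x by []; rewrite -(metrics_cover S) => -[g]; exists g.
have [m [B [r [m0 B0 r0 hg]]]] := gram_near Ac0 c0x gx.
set a := cmap c0 x in hg.
have [rU rU0 hU] : exists2 r, 0 < r & forall z, `|z - a| < r -> crange c0 z /\ U (cinv c0 z).
  by apply: cinv_nbhs; [exact: cmap_sub|rewrite cmapK].
pose R0 := Num.min r rU / 2.
have R00 : 0 < R0 by rewrite divr_gt0// lt_min r0 rU0.
have [R0r R0U] : R0 < r /\ R0 < rU.
  have h : 2 * R0 = Num.min r rU by rewrite mulrC divfK.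
  have h1 : Num.min r rU <= r by rewrite ge_min lexx.
  have h2 : Num.min r rU <= rU by rewrite ge_min lexx orbT.
  by split; lra.
pose K : R := 6 * n.+1%:R ^+ 2 * (B / m + 1).
have K0 : 0 <= K by rewrite mulr_ge0 ?mulr_ge0 ?exprn_ge0// addr_ge0// divr_ge0 ?(ltW m0) ?(ltW B0).
pose L := (Num.trunc ((8 * K) ^+ n / e)).+1.
have L0 : (0 < L)%N by [].
have hL : (8 * K) ^+ n / L%:R <= e.
  by rewrite ler_pdivrMr ?ltr0n// [leRHS]mulrC -ler_pdivrMr//; exact/ltW/truncnS_gt.
pose rL := bump_radius R0 L.-1.
have rL0 : 0 < rL by exact: bump_radius_gt0.
pose eps := rL / 2; have eps0 : 0 < eps by rewrite divr_gt0.
have epsL : 2 * eps <= rL by rewrite mulrC divfK.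
have [delta dg hd] := bump_chart_gauge n0 Ac0 c0x Sg m0 B0 eps0 R0r hg.
pose f := bump a R0 L.
pose u (p : M) := if `[< cdom c0 p >] then f (cmap c0 p) else 0.
have uE p : cdom c0 p -> u p = f (cmap c0 p) by move=> cp; rewrite /u; case: asboolP.
have u0 p : ~ (cdom c0 p /\ `|cmap c0 p - a| <= R0) -> u p = 0.
  move=> np; rewrite /u; case: asboolP => // cp; apply: bump0 => //.
  by rewrite leNgt; apply/negP => /ltW h; exact: np.
exists u, delta, [set p | cdom c0 p /\ `|cmap c0 p - a| < rL]; split => //.
- move=> c Ac A A0 I p z s y y' h1 h2 h3.
  pose near_i i := forall y, `|y - cmap c (p i)| < delta c (p i) ->
       ~ (cdom c0 (cinv c y) /\ `|cmap c0 (cinv c y) - a| <= R0).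
  have y_in i v : `|v - z i| < 3 * s i -> `|v - cmap c (p i)| < delta c (p i).
    move=> vz; have [_ _ _ h] := h1 i.
    have -> : v - cmap c (p i) = (v - z i) + (z i - cmap c (p i)) by rewrite addrA subrK.
    by apply: (le_lt_trans (ler_normD _ _)); lra.
  pose P := [pred i | ~~ `[< near_i i >]].
  rewrite (bigID (mem P))/= [X in _ + X]big1 ?addr0; last first.
    move=> i; rewrite inE negbK => /asboolP ni; have [yz y'z] := h2 i.
    by rewrite !u0 ?subrr ?normr0 ?expr0n ?gtn_eqF//; apply: ni; exact: y_in.
  have cell i : i \in P -> (forall y, `|y - cmap c (p i)| < delta c (p i) ->
      [/\ crange c y, cdom c0 (cinv c y) & `|transition c c0 y - cmap c0 (p i)| < eps]) /\
      exists rho, cell_image c c0 (p i) eps K A (z i) (s i) rho.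
    rewrite inE => /asboolP ni; have [cp rp s0 zs] := h1 i.
    have [//|[h4 h5]] := hd c (p i) Ac cp; split => //.
    exact: h5 A (z i) (s i) A0 rp s0 zs.
  have /choice[rho hrho] : forall i, exists rho, i \in P ->
      cell_image c c0 (p i) eps K A (z i) (s i) rho.
    move=> i; have [iP|] := boolP (i \in P); last by exists 0.
    by have [_ [rho h]] := cell i iP; exists rho.
  have uphi i v : i \in P -> `|v - z i| < 3 * s i -> u (cinv c v) = f (transition c c0 v).
    by move=> iP vz; have [/(_ v (y_in i v vz))[_ h _] _] := cell i iP; rewrite uE.
  rewrite (eq_bigr (fun i =>
    `|f (transition c c0 (y i)) - f (transition c c0 (y' i))| ^+ n)); last first.
    by move=> i iP; have [yz y'z] := h2 i; rewrite !(uphi i).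
  have zz i : i \in P -> `|z i - z i| < 3 * s i.
    by move=> iP; rewrite subrr normr0; have [_ _ s0 _] := h1 i; rewrite mulr_gt0.
  apply: (@le_trans _ _ ((8 * (A * K)) ^+ n / L%:R)).
    apply: (@bump_packing R n a R0 L n1 R00 L0 eps epsL I P _ _ (fun i => transition c c0 (z i))
      (fun i => cmap c0 (p i)) rho) => //.
    + by rewrite mulr_ge0// ltW.
    + move=> i iP; have [r1 r2 _ r3] := hrho i iP; split => //.
      by have [yz y'z] := h2 i; exact: r3.
    + move=> i iP; have [hy _] := cell i iP; have [yz y'z] := h2 i.
      by split; [have [] := hy _ (y_in i _ yz)|have [] := hy _ (y_in i _ y'z)
        |have [] := hy _ (y_in i _ (zz i iP))].
    + move=> i j iP jP w ij wi wj; apply: (h3 i j (transition c0 c w) ij).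
        by have [_ _ /(_ w wi)[]] := hrho i iP.
      by have [_ _ /(_ w wj)[]] := hrho j jP.
  by rewrite mulrCA exprMn -mulrA ler_wpM2l// exprn_ge0// ltW.
- by have := chart_nbhs c0x rL0.
- move=> y [c0y ya].
  have ball_t (t : R) : `[0, 1]%classic t -> `|a + t *: (cmap c0 y - a) - a| < rL.
    rewrite /= in_itv/= => /andP[t0 t1]; rewrite addrC addKr normrZ ger0_norm//.
    by apply: le_lt_trans ya; rewrite ler_piMl.
  have rLr : rL < r.
    apply: le_lt_trans R0r; have := bump_radius_last R00 L0 (Ordinal L0).
    by rewrite [X in _ <= X]/bump_radius expr0 divr1 -/rL; move: R00; clear; lra.
  have cr t (t01 : `[0, 1]%classic t) := hg _ (lt_trans (ball_t t t01) rLr).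
  exists ((fun t : R => cinv c0 (a + t *: (cmap c0 y - a))) @` `[0, 1]%classic); split.
  + by apply: chart_segment_connected => t /cr[].
  + by exists 0; rewrite /= ?in_itv/= ?lexx ?ler01// scale0r addr0 cmapK.
  + by exists 1; rewrite /= ?in_itv/= ?lexx ?ler01// scale1r addrC subrK cmapK.
  + move=> _ [t t01 <-]; have [ct _ _] := cr t t01.
    rewrite uE; last exact: cinv_sub.
    by rewrite cinvK// /f bump1// ltW// ball_t.
- move=> p; apply: contra_neqP => nU; apply: u0 => -[cp pR]; apply: nU.
  by have [_] := hU _ (le_lt_trans pR R0U); rewrite cmapK.
Qed.
End Energy.

(** * Grids in chart cubes *)

(** Compactness of the cube turns the pointwise gauge [d] into a uniform mesh:
    [l] is a Lebesgue number of the cover by the gauge balls. *)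
Lemma lebesgue_gauge (R : realType) n (a : 'rV[R]_n) (rho : R) (d : 'rV[R]_n -> R) :
  (forall y, 0 < d y) -> exists2 l, 0 < l & forall z, `|z - a| <= rho ->
    exists2 al, `|al - a| <= rho & `|z - al| + l <= d al.
Proof.
move=> d0; have /compact_near_coveringP cK := @closed_cube_compact R n a rho.
pose P (l : R) (z : 'rV[R]_n) := exists2 al, `|al - a| <= rho & `|z - al| + l <= d al.
have h : \forall l \near (0 : R)^'+, [set y | `|y - a| <= rho] `<=` P l.
  apply: cK => y /= ya.
  have e0 : 0 < d y / 2 by rewrite divr_gt0.
  near=> z l; exists y => //.
  have h1 : `|z - y| < d y / 2.
    by near: z; apply/nbhs_ballP; exists (d y / 2) => //= z; rewrite -ball_normE/= distrC.
  have h2 : l <= d y / 2 by near: l; apply: nbhs_right_le.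
  by apply: le_trans (lerD (ltW h1) h2) _; rewrite -splitr.
have [l [l0 hl]] : exists l : R, 0 < l /\ [set y | `|y - a| <= rho] `<=` P l.
  near (0 : R)^'+ => l; exists l; split; first by near: l; exact: nbhs_right_gt.
  by near: l.
by exists l.
Unshelve. all: by end_near. Qed.

Lemma truncn_eq_dist (R : realType) (v w : R) : 0 <= v -> 0 <= w ->
  Num.trunc v = Num.trunc w -> `|v - w| < 1.
Proof.
move=> v0 w0 vw; have /andP[v1 v2] := truncn_itv v0; have /andP[w1 w2] := truncn_itv w0.
rewrite vw -natr1 in v1 v2; rewrite -natr1 in w2.
by rewrite ltr_norml; apply/andP; split; lra.
Qed.

Lemma natr_dist_lt1 (R : realType) (p q : nat) : `|p%:R - q%:R : R| < 1 -> p = q.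
Proof.
have [pq|qp|//] := ltngtP p q.
- rewrite distrC ger0_norm ?subr_ge0 ?ler_nat 1?ltnW//.
  by rewrite ltrBlDr nat1r ltr_nat ltnS leqNgt pq.
- rewrite ger0_norm ?subr_ge0 ?ler_nat 1?ltnW//.
  by rewrite ltrBlDr nat1r ltr_nat ltnS leqNgt qp.
Qed.

Section GridCells.
Variables (R : realType) (n k : nat) (a : 'rV[R]_n) (rho : R).
Hypothesis rho0 : 0 < rho.
Local Notation N := (2 ^ k)%N.
Local Notation pt := {ffun 'I_n -> 'I_N}.

Definition mesh : R := 2 * rho / 2 ^+ k.

Lemma mesh_gt0 : 0 < mesh.
Proof. by rewrite !mulr_gt0// invr_gt0 exprn_gt0. Qed.

Lemma mesh_N : mesh * N%:R = 2 * rho.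
Proof. by rewrite natrX divfK// expf_neq0. Qed.

Definition center (x : pt) : 'rV[R]_n := \row_l (a 0 l - rho + mesh * ((x l)%:R + 2^-1)).

(** The index of the slab of the grid that contains the hyperplane with [l]-th
    coordinate [v]; [insubd] gives the slab [0] outside the cube. *)
Definition slab (l : 'I_n) (v : R) : 'I_N :=
  insubd (Ordinal (expn_gt0 2 k : (0 < 2 ^ k)%N)) (Num.trunc ((v - a 0 l + rho) / mesh)).

Lemma slab_arg l v : `|v - a 0 l| < rho -> 0 <= (v - a 0 l + rho) / mesh < N%:R.
Proof.
rewrite ltr_norml => /andP[v1 v2]; rewrite divr_ge0 ?(ltW mesh_gt0)//=; last by lra.
by rewrite ltr_pdivrMr ?mesh_gt0// mulrC mesh_N; lra.
Qed.

Lemma slabE l v : `|v - a 0 l| < rho ->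
  slab l v = Num.trunc ((v - a 0 l + rho) / mesh) :> nat.
Proof.
move=> /slab_arg/andP[v1 v2]; rewrite /slab val_insubd.
by rewrite truncn_lt_nat// v2.
Qed.

Lemma slab_inj l v w : `|v - a 0 l| < rho -> `|w - a 0 l| < rho -> slab l v = slab l w ->
  `|v - w| < mesh.
Proof.
move=> va wa /(congr1 val)/=; rewrite !slabE//.
have /andP[v0 _] := slab_arg va; have /andP[w0 _] := slab_arg wa.
move=> /(truncn_eq_dist v0 w0); rewrite -mulrBl normrM normfV (gtr0_norm mesh_gt0).
rewrite ltr_pdivrMr ?mesh_gt0// mul1r.
by have -> : v - a 0 l + rho - (w - a 0 l + rho) = v - w by ring.
Qed.

Definition cell (y : 'rV[R]_n) : pt := [ffun l => slab l (y 0 l)].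

Lemma row_sub_coord (y : 'rV[R]_n) l : `|y - a| < rho -> `|y 0 l - a 0 l| < rho.
Proof. by move=> ya; have := row_coord_le (y - a) l; rewrite !mxE => /le_lt_trans; exact. Qed.

Lemma cell_dist y : `|y - a| < rho -> `|y - center (cell y)| <= mesh / 2.
Proof.
move=> ya; apply: row_norm_le => [|l]; first by rewrite divr_ge0// ltW// mesh_gt0.
rewrite !mxE ffunE slabE; last exact: row_sub_coord.
have /andP[v0 _] := slab_arg (row_sub_coord l ya).
have /andP[] := truncn_itv v0; rewrite -natr1; set m := (Num.trunc _)%:R.
rewrite ler_pdivlMr ?mesh_gt0// ltr_pdivrMr ?mesh_gt0// => h1 h2.
by rewrite ler_norml; apply/andP; split; have := mesh_gt0; nra.
Qed.

Lemma center_near x : `|center x - a| <= rho.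
Proof.
apply: row_norm_le => [|l]; first exact: ltW.
rewrite !mxE; have xl : (x l)%:R + 1 <= N%:R :> R by rewrite natr1 ler_nat.
have x0 : 0 <= (x l)%:R :> R by [].
have := mesh_gt0; have := mesh_N => hN h0.
have h1 : mesh * ((x l)%:R + 1) <= 2 * rho by rewrite -hN ler_wpM2l// ltW.
have h2 : 0 <= mesh * (x l)%:R by rewrite mulr_ge0// ltW.
by rewrite ler_norml; apply/andP; split; nra.
Qed.

Lemma center_upd (x : pt) i (t : 'I_N) : t = (x i).+1 :> nat ->
  center (upd x i t) = center x + mesh *: delta_mx 0 i.
Proof.
move=> tx; apply/rowP => l; rewrite !mxE ffunE eqxx/=.
have [->|li] := eqVneq l i; first by rewrite tx -natr1 /= mulr1n; ring.
by rewrite mulr0 addr0.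
Qed.

Lemma center_disjoint (x x' : pt) w : x != x' -> `|w - center x| < mesh / 2 ->
  `|w - center x'| < mesh / 2 -> False.
Proof.
move=> xx' wx wx'; have [l xl] : exists l, x l != x' l.
  by apply/existsP; apply: contraNT xx'; rewrite negb_exists => /forallP h;
    apply/eqP/ffunP => l; apply/eqP; have := h l; rewrite negbK.
have h1 := le_lt_trans (row_coord_le _ l) wx; have h2 := le_lt_trans (row_coord_le _ l) wx'.
rewrite !mxE in h1 h2.
have m0 := mesh_gt0.
have dd : `|mesh * ((x l)%:R - (x' l)%:R)| < mesh.
  have -> : mesh * ((x l)%:R - (x' l)%:R) =
    (w 0 l - (a 0 l - rho + mesh * ((x' l)%:R + 2^-1))) -
    (w 0 l - (a 0 l - rho + mesh * ((x l)%:R + 2^-1))) by ring.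
  by apply: (le_lt_trans (ler_normB _ _)); lra.
move: dd; rewrite normrM (gtr0_norm m0) gtr_pMr// => /natr_dist_lt1/val_inj E.
by move: xl; rewrite E eqxx.
Qed.

End GridCells.

(** * Good slices of a chart cube *)

Lemma slice_count_arith (R : realType) (D e theta tau P rho J nr An : R) :
  D = 16 * rho * nr * (nr * An) -> D * e < theta * tau -> 0 < P -> 0 < tau -> 0 < rho ->
  theta * P < 8 * rho * J -> 2 * nr * (P * (nr * (An * e))) < tau * J.
Proof.
move=> DE De P0 tau0 rho0 JJ.
have h1 : D * e * P < theta * tau * P by rewrite ltr_pM2r.
have h2 : tau * (theta * P) < tau * (8 * rho * J) by rewrite ltr_pM2l.
have r8 : 0 < 8 * rho by rewrite mulr_gt0.
rewrite -(ltr_pM2l r8); have -> : 8 * rho * (2 * nr * (P * (nr * (An * e)))) = D * e * P.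
  by rewrite DE; ring.
by apply: (lt_trans h1); lra.
Qed.

Section LocalSlices.
Variables (R : realType) (n : nat) (M : manifold R n) (S : conformal_structure M).
Hypothesis n1 : (1 < n)%N.
Variables (c : chart R n M) (a : 'rV[R]_n) (rho A : R).
Hypotheses (Ac : atlas c) (rho0 : 0 < rho) (A0 : 0 < A).
Hypothesis cube : forall y, `|y - a| <= rho -> crange c y /\ round_at S c (cinv c y) A.

Section FixedMesh.
Variables (u : M -> R) (delta : chart R n M -> M -> R) (e : R) (k : nat).
Hypotheses (ue : energy_le S u delta e).
Local Notation h := (mesh k rho).
Local Notation pt := {ffun 'I_n -> 'I_(2 ^ k)}.
Hypothesis fine : forall z, `|z - a| <= rho -> exists2 al, `|al - a| <= rho &
  `|z - al| + 3 * (h / 2) <= delta c (cinv c al).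

(* [F] samples [u] at the centres of the cells, and [G] compares it with the
   next centre in each direction, which belongs to the threefold dilate of the
   cell. For the last cell of a row, this is a point outside the cube. *)
Let F (x : pt) := u (cinv c (center a rho x)).
Let G (x : pt) := \sum_(i < n)
  `|u (cinv c (center a rho x + h *: delta_mx 0 i)) - u (cinv c (center a rho x))| ^+ n.

Lemma grid_packing (I : finType) (f : I -> pt) (y y' : I -> 'rV[R]_n) : injective f ->
  (forall i, `|y i - center a rho (f i)| < 3 * (h / 2) /\
     `|y' i - center a rho (f i)| < 3 * (h / 2)) ->
  \sum_i `|u (cinv c (y i)) - u (cinv c (y' i))| ^+ n <= A ^+ n * e.
Proof.
move=> finj hy.
have /choice[al hal] : forall i, exists al, `|al - a| <= rho /\
    `|center a rho (f i) - al| + 3 * (h / 2) <= delta c (cinv c al).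
  by move=> i; have [al h1 h2] := fine (center_near a rho0 (f i)); exists al.
apply: (@ue c Ac A A0 I (fun i => cinv c (al i))
  (fun i => center a rho (f i)) (fun=> h / 2) y y') => //.
  move=> i; have [h1 h2] := hal i; have [ci ri] := cube h1.
  split => //; [exact: cinv_sub|by rewrite divr_gt0 ?mesh_gt0|by rewrite cinvK].
move=> i j w ij; apply: center_disjoint => //.
by apply: contra_neq ij; exact: finj.
Qed.

Lemma grid_bound_mesh : grid_bound F G.
Proof.
split=> [x|x i t tx]; first by apply: sumr_ge0 => i _; rewrite exprn_ge0.
rewrite /F center_upd// /G (bigD1 i)//= lerDl.
by apply: sumr_ge0 => j _; rewrite exprn_ge0.
Qed.

Lemma grid_energy : \sum_x G x <= n%:R * (A ^+ n * e).
Proof.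
rewrite /G exchange_big/=.
apply: (@le_trans _ _ (\sum_(i < n) A ^+ n * e)); last first.
  by rewrite sumr_const card_ord mulr_natl.
have h0 : 0 < h := mesh_gt0 k rho0.
apply: ler_sum => i _; apply: (@grid_packing _ id) => // x; split.
  rewrite addrC addKr normrZ (gtr0_norm h0).
  have : `|delta_mx 0 i : 'rV[R]_n| <= 1.
    apply: row_norm_le => // l; rewrite mxE /=.
    by case: (l == i); rewrite ?normr1 ?normr0.
  move=> h1; have : h * `|delta_mx 0 i : 'rV[R]_n| <= h by rewrite ler_piMr// ltW.
  by move=> h2; apply: (le_lt_trans h2); lra.
by rewrite subrr normr0 !mulr_gt0// invr_gt0.
Qed.

Lemma cell_value y eta : 0 <= eta -> A ^+ n * e <= eta ^+ n -> `|y - a| < rho ->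
  `|u (cinv c y) - F (cell k a rho y)| <= eta.
Proof.
move=> eta0 he ya; have n0 : (0 < n)%N by exact: ltnW.
rewrite -(@ler_pXn2r _ n)// ?nnegrE//; apply: le_trans he.
have := @grid_packing unit (fun=> cell k a rho y) (fun=> y) (fun=> center a rho (cell k a rho y)).
rewrite big_const card_unit /= addr0; apply; first by case; case.
move=> _; rewrite subrr normr0; have h0 : 0 < h := mesh_gt0 k rho0.
have := cell_dist k rho0 ya; split; last by rewrite !mulr_gt0// invr_gt0.
by lra.
Qed.

End FixedMesh.

(** The oscillation is tested on the grid of a mesh below the Lebesgue number of
    the gauge, so its fineness depends on [u], while [e] must not. The Morrey
    bound is independent of the mesh: at most a fixed fraction, of order [e], of
    the slabs are bad in each of the [n] directions. The [2 n] faces of the cube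
    of half-side [t] around [b] have to avoid the bad slabs at the same time;
    when [t] runs through multiples of the mesh in an interval of length of
    order [theta], each bad slab excludes one value of [t] for each face, and
    some value remains. *)
Lemma local_slices eta theta : 0 < eta -> 0 < theta -> exists2 e, 0 < e &
  forall u delta, gauge delta -> energy_le S u delta e ->
  forall b tau, 0 <= tau -> `|b - a| + tau + theta <= rho ->
  exists t, [/\ tau < t, t < tau + theta & forall (i : 'I_n) sigma,
    sigma = b 0 i + t \/ sigma = b 0 i - t -> forall y y', `|y - a| < rho -> `|y' - a| < rho ->
    y 0 i = sigma -> y' 0 i = sigma -> `|u (cinv c y) - u (cinv c y')| <= eta].
Proof.
move=> eta0 theta0; have n0 : (0 < n)%N by exact: ltnW.
have [K K0 HK] := @morrey_slices R n n1.
pose eta1 := eta / 3; have eta10 : 0 < eta1 by rewrite divr_gt0.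
pose tau0 := eta1 ^+ n / (K + 1).
have tau00 : 0 < tau0 by rewrite divr_gt0 ?exprn_gt0//; lra.
have Ktau : K * tau0 <= eta1 ^+ n.
  by rewrite /tau0 mulrCA ler_piMr ?exprn_ge0 ?(ltW eta10)// ler_pdivrMr ?mul1r; lra.
(* [D * e] compares the number of bad values of [t] with the number available,
   as computed in [slice_count_arith]. *)
pose D := 16 * rho * n%:R * (n%:R * A ^+ n).
have nr0 : 0 < n%:R :> R by rewrite ltr0n.
have An0 : 0 < A ^+ n by rewrite exprn_gt0.
have D0 : 0 < D by do !apply: mulr_gt0.
pose e := Num.min (eta1 ^+ n / A ^+ n) (theta * tau0 / (2 * D)).
have e0 : 0 < e.
  rewrite lt_min; apply/andP; split; apply: divr_gt0 => //; first exact: exprn_gt0.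
    exact: mulr_gt0.
  exact: mulr_gt0.
have e1 : A ^+ n * e <= eta1 ^+ n.
  by rewrite mulrC -ler_pdivlMr// ge_min lexx.
have e2 : D * e < theta * tau0.
  have : e <= theta * tau0 / (2 * D) by rewrite ge_min lexx orbT.
  rewrite ler_pdivlMr ?mulr_gt0// => h; have : 0 < theta * tau0 by rewrite mulr_gt0.
  lra.
exists e => // u delta dg ue b tau tau_ge0 bt.
have [l l0 hl] := @lebesgue_gauge R n a rho (fun al => delta c (cinv c al)) (fun al => dg _ _).
have [k hk] := @pow2_small R (Num.min (l / (3 * rho)) (theta / (4 * rho)))
  ltac:(by rewrite lt_min !divr_gt0 ?mulr_gt0).
pose h := mesh k rho; have h0 : 0 < h := mesh_gt0 k rho0.
have hE : h = 2 * rho * (2 ^+ k)^-1 by [].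
have hl3 : 3 * (h / 2) <= l.
  have : (2 ^+ k)^-1 <= l / (3 * rho) by apply: le_trans (ltW hk) _; rewrite ge_min lexx.
  rewrite ler_pdivlMr ?mulr_gt0// hE; lra.
have hth : 2 * h <= theta.
  have : (2 ^+ k)^-1 <= theta / (4 * rho) by apply: le_trans (ltW hk) _; rewrite ge_min lexx orbT.
  rewrite ler_pdivlMr ?mulr_gt0// hE; lra.
have fine z : `|z - a| <= rho -> exists2 al, `|al - a| <= rho &
  `|z - al| + 3 * (h / 2) <= delta c (cinv c al).
  by move=> /hl[al h1 h2]; exists al => //; apply: le_trans h2; rewrite lerD2l.
have gb := grid_bound_mesh u k; have ge := grid_energy ue fine.
have /choice[bad hbad] : forall i, exists bad : {set 'I_(2 ^ k)},
    tau0 * #|bad|%:R <= 2 ^+ k * (n%:R * (A ^+ n * e)) /\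
    forall t (x y : {ffun 'I_n -> 'I_(2 ^ k)}), t \notin bad -> x i = t -> y i = t ->
      `|u (cinv c (center a rho x)) - u (cinv c (center a rho y))| <= eta1.
  move=> i; have [bad h1 h2] := HK k _ _ gb i tau0 (ltW tau00).
  exists bad; split=> [|t x y tb xt yt].
    by apply: (le_trans h1); rewrite ler_wpM2l// exprn_ge0.
  rewrite -(@ler_pXn2r _ n)// ?nnegrE ?(ltW eta10)//; apply: le_trans Ktau.
  exact: h2 tb xt yt.
pose q := theta / (2 * h); have q1 : 1 <= q by rewrite ler_pdivlMr ?mulr_gt0// mul1r.
pose J := Num.trunc q.
have /andP[J1 J2] := truncn_itv (le_trans ler01 q1); rewrite -/J -natr1 in J1 J2.
have J0 : (0 < J)%N by rewrite truncn_gt0.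
have J0r : 1 <= J%:R :> R by rewrite ler1n.
have qh : q * h = theta / 2.
  rewrite /q; field; rewrite gt_eqF//.
pose t (j : 'I_J) : R := tau + (j.+1)%:R * h.
have tP (j : 'I_J) : tau < t j /\ t j <= tau + theta / 2.
  split; first by rewrite /t ltrDl mulr_gt0.
  rewrite /t lerD2l -qh ler_wpM2r ?(ltW h0)//; apply: le_trans J1; rewrite ler_nat.
  exact: ltn_ord.
pose val (s : bool) (i : 'I_n) (j : 'I_J) := if s then b 0 i + t j else b 0 i - t j.
have val_in s i j : `|val s i j - a 0 i| < rho.
  have ba : `|b 0 i - a 0 i| <= `|b - a| by have := row_coord_le (b - a) i; rewrite !mxE.
  have [t1 t2] := tP j.
  have tt : `|(if s then t j else - t j)| < tau + theta.
    have ->: `|(if s then t j else - t j)| = t j.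
      by case: s; rewrite ?normrN ger0_norm//; lra.
    by lra.
  have -> : val s i j - a 0 i = (b 0 i - a 0 i) + (if s then t j else - t j).
    by rewrite /val; clear tt; case: s; ring.
  by apply: (le_lt_trans (ler_normD _ _)); lra.
have [[j hj]|nex] := pselect (exists j : 'I_J, forall s i, slab k a rho i (val s i j) \notin bad i).
  exists (t j); have [t1 t2] := tP j; split => //; first by lra.
  move=> i sigma hs y y' ya y'a yi y'i.
  have [s sE] : exists s, sigma = val s i j by case: hs => ->; [exists true|exists false].
  have h1 := cell_value ue fine (ltW eta10) e1 ya.
  have h2 := cell_value ue fine (ltW eta10) e1 y'a.
  have [_ hb] := hbad i.
  have h3 := hb _ (cell k a rho y) (cell k a rho y') (hj s i).
  rewrite /cell !ffunE yi y'i sE in h3; have {}h3 := h3 erefl erefl.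
  rewrite distrC in h2.
  have -> : eta = eta1 + eta1 + eta1 by rewrite /eta1; field.
  apply: (le_trans (ler_distD (u (cinv c (center a rho (cell k a rho y')))) _ _)).
  apply: lerD => //.
  apply: (le_trans (ler_distD (u (cinv c (center a rho (cell k a rho y)))) _ _)).
  by apply: lerD => //; rewrite /cell; exact: h3.
(* Each candidate [t j] fails for one face, namely a sign and a direction. *)
exfalso.
pose B (si : bool * 'I_n) := [pred j : 'I_J | slab k a rho si.2 (val si.1 si.2 j) \in bad si.2].
have Bcard si : (#|B si| <= #|bad si.2|)%N.
  case: si => s i /=.
  have inj : {in B (s, i) &, injective (fun j => slab k a rho i (val s i j))}.
    move=> j j' _ _ /(slab_inj rho0 (val_in s i j) (val_in s i j')) dd.
    have {}dd : `|(j : nat)%:R - (j' : nat)%:R| * h < h.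
      have -> : `|(j : nat)%:R - (j' : nat)%:R| * h = `|val s i j - val s i j'|.
        rewrite -{1}(gtr0_norm h0) -normrM /val /t -!natr1; case: s {val_in dd} => /=.
          by congr `|_|; ring.
        by rewrite distrC; congr `|_|; ring.
      exact: dd.
    move: dd; rewrite gtr_pMl// => /natr_dist_lt1 jj'; exact: val_inj.
  apply: (@leq_trans #|(fun j => slab k a rho i (val s i j)) @: B (s, i)|).
    by rewrite (card_in_imset inj).
  by apply/subset_leq_card/fintype.subsetP => _ /imsetP[j jB ->].
have JB : (J <= \sum_(si : bool * 'I_n) #|B si|)%N.
  have -> : (\sum_(si : bool * 'I_n) #|B si| = \sum_(j < J) \sum_(si : bool * 'I_n) (j \in B si))%N.
    rewrite exchange_big/=; apply: eq_bigr => si _.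
    by rewrite -sum1_card big_mkcond/=; apply: eq_bigr => j _; case: ifP.
  rewrite -[X in (X <= _)%N]card_ord -sum1_card; apply: leq_sum => j _.
  have [s [i si]] : exists s i, slab k a rho i (val s i j) \in bad i.
    apply: contrapT => nsi; apply: nex; exists j => s i; apply/negP => si.
    by apply: nsi; exists s, i.
  by rewrite (bigD1 (s, i))//= inE/= si.
have : tau0 * J%:R <= 2 * n%:R * (2 ^+ k * (n%:R * (A ^+ n * e))).
  apply: (@le_trans _ _ (\sum_(si : bool * 'I_n) tau0 * #|bad si.2|%:R)).
    rewrite -mulr_sumr ler_wpM2l ?(ltW tau00)// -natr_sum ler_nat.
    by apply: (leq_trans JB); apply: leq_sum => si _; exact: Bcard.
  apply: (@le_trans _ _ (\sum_(si : bool * 'I_n) 2 ^+ k * (n%:R * (A ^+ n * e)))).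
    by apply: ler_sum => si _; have [] := hbad si.2.
  by rewrite sumr_const card_prod card_bool card_ord -[leLHS]mulr_natl natrM.
apply/negP; rewrite -ltNge.
have p0 : 0 < 2 ^+ k :> R by rewrite exprn_gt0.
have hp : h * 2 ^+ k = 2 * rho by rewrite hE divfK// gt_eqF.
have Jq : q < 2 * J%:R by lra.
have JJ : theta * 2 ^+ k < 8 * rho * J%:R.
  have : theta < 4 * (h * J%:R).
    have : q * h < 2 * J%:R * h by rewrite ltr_pM2r.
    by rewrite qh; lra.
  move=> hth4; apply: (@lt_le_trans _ _ (4 * (h * J%:R) * 2 ^+ k)); first by rewrite ltr_pM2r.
  have -> : 4 * (h * J%:R) * 2 ^+ k = 4 * J%:R * (h * 2 ^+ k) by ring.
  by rewrite hp; lra.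
exact: (slice_count_arith (erefl D) e2 p0 tau00 rho0 JJ).
Qed.

End LocalSlices.

(** * Small values on large continua *)

Section Control.
Variables (R : realType) (n : nat) (M : manifold R n) (S : conformal_structure M).
Hypothesis n1 : (1 < n)%N.
Implicit Types (c : chart R n M) (u : M -> R) (delta : chart R n M -> M -> R).

(** Otherwise the open cube would cut out of [C] a set that is also closed,
    because the closed cube is closed in a Hausdorff space. *)
Lemma connected_crosses_sphere c (b : 'rV[R]_n) (t : R) (C : set M) p0 p1 :
  (forall y, `|y - b| <= t -> crange c y) -> connected C ->
  C p0 -> cdom c p0 -> `|cmap c p0 - b| < t ->
  C p1 -> ~ (cdom c p1 /\ `|cmap c p1 - b| < t) ->
  exists p, [/\ C p, cdom c p & `|cmap c p - b| = t].
Proof.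
move=> bt conC Cp0 cp0 p0t Cp1 np1; apply: contrapT => nex; apply: np1.
pose O := [set p | cdom c p /\ `|cmap c p - b| < t].
suff CO : C `&` O = C by have [] : (C `&` O) p1 by rewrite CO.
apply: conC.
- by exists p0.
- by exists O => //; exact: chart_ball_open.
- exists [set p | cdom c p /\ `|cmap c p - b| <= t].
    by apply: chart_closed_cube => //; exact: carrier_hausdorff.
  apply/seteqP; split => p [Cp [cp pt]]; split => //; split => //; first exact: ltW.
  rewrite lt_neqAle pt andbT; apply/eqP => E; apply: nex; exists p; split => //.
Qed.

Lemma norm_coord (v : 'rV[R]_n) t : 0 < t -> `|v| = t -> exists i, v 0 i = t \/ v 0 i = - t.
Proof.
move=> t0 vt; have [ij E] : exists ij, `|v| = `|v ij.1 ij.2|.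
  by apply: mx_norm_neq0; rewrite -[mx_norm v]/(`|v|) vt gt_eqF.
exists ij.2; move: E; rewrite vt [ij.1]ord1; case: (lerP 0 (v 0 ij.2)) => h E.
  by left; rewrite E ger0_norm.
by right; rewrite E ltr0_norm// opprK.
Qed.

Definition set_coord (y : 'rV[R]_n) (i : 'I_n) (s : R) : 'rV[R]_n :=
  \row_l if l == i then s else y 0 l.

Lemma set_coordE y i s l : set_coord y i s 0 l = if l == i then s else y 0 l.
Proof. by rewrite mxE. Qed.

Lemma set_coord_near (a y : 'rV[R]_n) i s rho : 0 < rho -> `|y - a| < rho -> `|s - a 0 i| < rho ->
  `|set_coord y i s - a| < rho.
Proof.
move=> rho0 ya sa; apply: row_norm_lt => // l; rewrite !mxE.
case: eqP => [->//|_]; have := row_coord_le (y - a) l; rewrite !mxE => /le_lt_trans; exact.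
Qed.

Section Cube.
Variables (c : chart R n M) (a : 'rV[R]_n) (rho A : R).
Hypotheses (Ac : atlas c) (rho0 : 0 < rho) (A0 : 0 < A).
Hypothesis cube : forall y, `|y - a| <= rho -> crange c y /\ round_at S c (cinv c y) A.

Lemma cube_radius y U : `|y - a| < rho -> nbhs (cinv c y) U -> exists theta,
  [/\ 0 < theta, `|y - a| + theta <= rho & forall z, `|z - y| < theta -> U (cinv c z)].
Proof.
move=> ya yU; have [cy _] := cube (ltW ya).
have [r r0 h] := cinv_nbhs cy yU.
exists (Num.min r (rho - `|y - a|)); split.
- by rewrite lt_min r0 subr_gt0.
- by rewrite -lerBrDl ge_min lexx orbT.
- by move=> z; rewrite lt_min => /andP[/h[]].
Qed.

(** A continuum that starts close to [y2] and leaves [U] crosses the boundary of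
    the cube of half-side [t] around [b], all of whose faces are good slices;
    let [p] be the crossing point and [i] the direction of the face. If [i]
    differs from [i0], this face meets the slice on which [u] is small. If
    [i = i0] the two are parallel, and a third good slice, transversal to both,
    connects them; it costs another [eta]. *)
Lemma control_near y2 U : cdom c y2 -> `|cmap c y2 - a| < rho -> nbhs y2 U ->
  exists2 V, nbhs y2 V & forall eta, 0 < eta -> exists2 e, 0 < e &
  forall u delta, gauge delta -> energy_le S u delta e ->
  forall (i0 : 'I_n) s0, `|s0 - a 0 i0| < rho ->
    (forall y, `|y - a| < rho -> y 0 i0 = s0 -> u (cinv c y) <= eta) ->
  forall C, connected C -> C `&` V !=set0 -> ~ C `<=` U -> exists2 p, C p & u p <= 3 * eta.
Proof.
move=> cy2 y2a y2U; set b := cmap c y2.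
have [theta [th0 bth hU]] : exists theta, [/\ 0 < theta, `|b - a| + theta <= rho &
    forall z, `|z - b| < theta -> U (cinv c z)].
  by apply: cube_radius => //; rewrite cmapK.
have th20 : 0 < theta / 2 by rewrite divr_gt0.
(* The cube of half-side [t] has [theta / 2 < t < theta]: it surrounds the
   neighbourhood chosen here and stays inside [U]. *)
exists [set p | cdom c p /\ `|cmap c p - b| < theta / 2]; first exact: chart_nbhs.
move=> eta eta0.
have [e e0 he] := @local_slices R n M S n1 c a rho A Ac rho0 A0 cube eta (theta / 2) eta0 th20.
exists e => // u delta dg ue i0 s0 s0a hs0 C conC [p0 [Cp0 [cp0 p0b]]] CU.
have [p1 [Cp1 nUp1]] : exists p1, C p1 /\ ~ U p1.
  by apply: contrapT => h; apply: CU => p Cp; apply: contrapT => nU; apply: h; exists p.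
have ba : 0 <= `|b - a| by [].
have [|t [t1 t2 ht]] := he u delta dg ue b (theta / 2) (ltW th20); first by lra.
have [|t' [t'1 t'2 ht']] := he u delta dg ue a 0 (lexx 0); first by rewrite subrr normr0; lra.
have [p [Cp cp pb]] : exists p, [/\ C p, cdom c p & `|cmap c p - b| = t].
  apply: (@connected_crosses_sphere c b t C p0 p1) => //; last first.
  - move=> [cp1 p1t]; apply: nUp1; rewrite -(cmapK cp1); apply: hU; lra.
  - lra.
  move=> y yb; have [] // : crange c y /\ round_at S c (cinv c y) A.
  apply: cube; rewrite (_ : y - a = (y - b) + (b - a)); last by rewrite addrA subrK.
  by apply: (le_trans (ler_normD _ _)); lra.
have pa : `|cmap c p - a| < rho.
  rewrite (_ : cmap c p - a = (cmap c p - b) + (b - a)); last by rewrite addrA subrK.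
  by apply: (le_lt_trans (ler_normD _ _)); lra.
have t0 : 0 < t by lra.
have [i hi] := norm_coord t0 pb; rewrite !mxE in hi.
exists p => //.
have good_p := ht i (cmap c p 0 i) _ _ _ pa.
have {}good_p y' : `|y' - a| < rho -> y' 0 i = cmap c p 0 i -> u p <= u (cinv c y') + eta.
  move=> y'a y'i; have := good_p _ y' y'a erefl y'i; rewrite cmapK//.
  have hs : cmap c p 0 i = b 0 i + t \/ cmap c p 0 i = b 0 i - t.
    by case: hi => hi; [left|right]; lra.
  by move=> /(_ hs); rewrite ler_norml => /andP[_]; rewrite lerBlDl addrC.
have [ii0|ii0] := eqVneq i i0; last first.
  have wa := set_coord_near rho0 pa s0a.
  have h1 := good_p _ wa; rewrite set_coordE (negbTE ii0) in h1.
  have h2 := hs0 _ wa; rewrite set_coordE eqxx in h2.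
  by have := h1 erefl; have := h2 erefl; lra.
have [i1 i10] : exists i1 : 'I_n, i1 != i0.
  have n0 : (0 < n)%N by exact: ltnW.
  have [E|E] := eqVneq i0 (Ordinal n0); last by exists (Ordinal n0); rewrite eq_sym.
  by exists (Ordinal n1); rewrite E.
pose s1 := a 0 i1 + t'.
have s1a : `|s1 - a 0 i1| < rho.
  by rewrite /s1 addrC addKr ger0_norm; lra.
have w1a := set_coord_near rho0 pa s1a; set w1 := set_coord _ _ _ in w1a.
have w2a := set_coord_near rho0 w1a s0a; set w2 := set_coord _ _ _ in w2a.
have h1 := good_p w1 w1a; rewrite set_coordE ii0 eq_sym (negbTE i10) in h1.
have h2 := hs0 w2 w2a; rewrite set_coordE eqxx in h2.
have w11 : w1 0 i1 = s1 by rewrite set_coordE eqxx.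
have w21 : w2 0 i1 = s1 by rewrite set_coordE (negbTE i10).
have := ht' i1 s1 (or_introl erefl) w1 w2 w1a w2a w11 w21.
rewrite ler_norml => /andP[_ h3].
by have := h1 erefl; have := h2 erefl; lra.
Qed.

End Cube.
End Control.

(** * Propagation along a component *)

Section Propagation.
Variables (R : realType) (n : nat) (M : manifold R n) (S : conformal_structure M).
Hypothesis n1 : (1 < n)%N.
Variable adm : R -> (M -> R) -> (chart R n M -> M -> R) -> Prop.
Hypothesis adm_energy : forall e u delta, adm e u delta -> gauge delta /\ energy_le S u delta e.
Hypothesis adm_mono : forall e f u delta, e <= f -> adm e u delta -> adm f u delta.

(** At a controlled point, functions of small energy cannot be large on a
    continuum that starts near [x] and leaves a given neighbourhood. Both the
    neighbourhood [V] and the bound [e] are uniform in [u]. *)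
Definition controlled (x : M) := forall U, nbhs x U ->
  exists2 V, nbhs x V & forall eta, 0 < eta -> exists2 e, 0 < e &
  forall u delta, adm e u delta -> forall C, connected C -> C `&` V !=set0 -> ~ C `<=` U ->
  exists2 p, C p & u p <= eta.

Section Cube.
Variables (c : chart R n M) (a : 'rV[R]_n) (rho A : R).
Hypotheses (Ac : atlas c) (rho0 : 0 < rho) (A0 : 0 < A).
Hypothesis cube : forall y, `|y - a| <= rho -> crange c y /\ round_at S c (cinv c y) A.

Let n0 : (0 < n)%N. Proof. exact: ltnW. Qed.
Let i0 : 'I_n := Ordinal n0.
Let i1 : 'I_n := Ordinal n1.

(** Controlled points are used through short segments, which are continua: a
    segment close to [y1] inside a good slice contains a point where [u] is
    small, and [u] is almost constant on the slice. The segment runs in the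
    direction [i1], inside a slice orthogonal to [i0]; this takes two
    dimensions. *)
Lemma controlled_slice y1 eta : cdom c y1 -> `|cmap c y1 - a| < rho -> controlled y1 ->
  0 < eta -> exists2 e, 0 < e & forall u delta, adm e u delta ->
  exists2 s0, `|s0 - a 0 i0| < rho &
    forall y, `|y - a| < rho -> y 0 i0 = s0 -> u (cinv c y) <= 2 * eta.
Proof.
move=> cy1 y1a ctrl eta0; set b := cmap c y1.
have [theta [th0 bth _]] : exists theta, [/\ 0 < theta, `|b - a| + theta <= rho &
    forall z, `|z - b| < theta -> [set: M] (cinv c z)].
  by apply: (cube_radius cube) => //; exact: filterT.
pose th1 := theta / 2; have th10 : 0 < th1 by rewrite divr_gt0.
have th1E : theta = 2 * th1 by rewrite mulrC divfK.
have [V nV hV] := ctrl _ (chart_nbhs cy1 th10).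
have [r [r0 _ hr]] : exists r, [/\ 0 < r, `|b - a| + r <= rho &
    forall z, `|z - b| < r -> V (cinv c z)].
  by apply: (cube_radius cube); rewrite ?cmapK.
pose r1 := Num.min r th1; have r10 : 0 < r1 by rewrite lt_min r0.
have [r1r r1t] : r1 <= r /\ r1 <= th1 by rewrite !ge_min !lexx orbT.
have [e1 e10 he1] := hV eta eta0.
have [e2 e20 he2] := @local_slices R n M S n1 c a rho A Ac rho0 A0 cube eta r1 eta0 r10.
exists (Num.min e1 e2); first by rewrite lt_min e10.
move=> u delta ad; have [dg _] := adm_energy ad.
have ad1 : adm e1 u delta by apply: adm_mono ad; rewrite ge_min lexx.
have [_ ue] : gauge delta /\ energy_le S u delta e2.
  by apply/adm_energy/(adm_mono _ ad); rewrite ge_min lexx orbT.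
have ba : 0 <= `|b - a| by [].
have [|t [t0 tr1 ht]] := he2 u delta dg ue b 0 (lexx 0); first by lra.
rewrite add0r in tr1.
pose q0 := set_coord b i0 (b 0 i0 + t); pose v : 'rV[R]_n := th1 *: delta_mx 0 i1.
have i10 : (i1 == i0) = false by [].
have segE s l : (q0 + s *: v - b) 0 l =
    (if l == i0 then t else 0) + (if l == i1 then s * th1 else 0).
  rewrite !mxE eqxx/=; case: (eqVneq l i0) => [->|_]; case: (eqVneq _ i1) => _ //=;
    rewrite ?mulr1 ?mulr0; ring.
have seg s : 0 <= s <= 1 -> `|q0 + s *: v - b| <= th1.
  move=> /andP[s0 s1]; have sth : 0 <= s * th1 <= th1.
    by rewrite mulr_ge0 ?(ltW th10)//= ler_piMl// ltW.
  apply: row_norm_le => [|l]; first exact: ltW.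
  rewrite segE.
  have [->|_] := eqVneq l i0.
    by rewrite eq_sym i10 addr0 ger0_norm; lra.
  by rewrite add0r; case: ifP => _; rewrite ?normr0 ?ger0_norm; lra.
have seg_a s : 0 <= s <= 1 -> `|q0 + s *: v - a| < rho.
  move=> /seg h; rewrite (_ : q0 + s *: v - a = (q0 + s *: v - b) + (b - a)); last first.
    by rewrite addrA subrK.
  by apply: (le_lt_trans (ler_normD _ _)); lra.
pose F := (fun s : R => cinv c (q0 + s *: v)) @` `[0, 1]%classic.
have conF : connected F.
  apply: chart_segment_connected => s; rewrite /= in_itv/= => /seg_a/ltW h.
  by have [] := cube h.
have F0 : F (cinv c q0).
  by exists 0; rewrite /= ?in_itv/= ?lexx ?ler01// scale0r addr0.
have F1 : F (cinv c (q0 + v)).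
  by exists 1; rewrite /= ?in_itv/= ?lexx ?ler01// scale1r.
have [||_ [s sI <-] us] := he1 u delta ad1 F conF.
- exists (cinv c q0); split => //; apply: hr; apply: lt_le_trans r1r.
  apply: row_norm_lt => // l; rewrite -[q0]addr0 -(scale0r v) segE mul0r if_same addr0.
  by case: ifP => _; rewrite ?normr0// ger0_norm// ltW.
- move=> FU; have [_] := FU _ F1.
  have h1 : `|q0 + v - a| < rho by have := @seg_a 1; rewrite scale1r lexx ler01; exact.
  have [cq _] := cube (ltW h1); rewrite cinvK// -/b ltNge => /negP; apply.
  apply: le_trans (row_coord_le _ i1); rewrite -[v]scale1r segE eqxx i10 add0r mul1r.
  exact: ler_norm.
have s01 : 0 <= s <= 1 by move: sI; rewrite /= in_itv.
have sa := seg_a s s01.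
have q0i : (q0 + s *: v) 0 i0 = b 0 i0 + t.
  have := segE s i0; rewrite eqxx addr0 [LHS]mxE [(- b) 0 i0]mxE => <-; ring.
exists (b 0 i0 + t).
  by rewrite -q0i; have := row_coord_le (q0 + s *: v - a) i0; rewrite !mxE => /le_lt_trans; exact.
move=> y ya yi; have := ht i0 (b 0 i0 + t) (or_introl erefl) y (q0 + s *: v) ya sa yi q0i.
by rewrite ler_norml => /andP[_]; lra.
Qed.

(** A slice on which [u] is small reaches across the whole cube, from [y1] to
    [y2]. The losses are a factor two in [controlled_slice] and three in
    [control_near]. *)
Lemma controlled_transfer y1 y2 : cdom c y1 -> `|cmap c y1 - a| < rho ->
  cdom c y2 -> `|cmap c y2 - a| < rho -> controlled y1 -> controlled y2.
Proof.
move=> cy1 y1a cy2 y2a ctrl U nU.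
have [V nV hV] := control_near n1 Ac rho0 A0 cube cy2 y2a nU.
exists V => // eta eta0.
have eta60 : 0 < eta / 6 by rewrite divr_gt0.
have [e1 e10 he1] := controlled_slice cy1 y1a ctrl eta60.
have [e2 e20 he2] := hV (2 * (eta / 6)) ltac:(by rewrite mulr_gt0).
exists (Num.min e1 e2); first by rewrite lt_min e10.
move=> u delta ad C conC CV CU; have [dg _] := adm_energy ad.
have ad1 : adm e1 u delta by apply: adm_mono ad; rewrite ge_min lexx.
have [_ ue] : gauge delta /\ energy_le S u delta e2.
  by apply/adm_energy/(adm_mono _ ad); rewrite ge_min lexx orbT.
have [s0 s0a hs] := he1 u delta ad1.
have [p Cp up] := he2 u delta dg ue i0 s0 s0a hs C conC CV CU.
by exists p => //; apply: (le_trans up); lra.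
Qed.

End Cube.

(** By [controlled_transfer], the set of controlled points and its complement
    are both open. *)
Lemma controlled_component x b0 :
  connected_component [set: M] x b0 -> controlled b0 -> controlled x.
Proof.
move=> xb cb0.
have nb z : exists2 W, nbhs z W & forall y, W y -> (controlled z <-> controlled y).
  have [c Ac cz] : exists2 c, atlas c & cdom c z.
    by have : [set: M] z by []; rewrite -(atlas_maximal M).1.1 => -[c]; exists c.
  have [A [r [A0 r0 h]]] := round_near S Ac cz.
  have r20 : 0 < r / 2 by rewrite divr_gt0.
  exists [set p | cdom c p /\ `|cmap c p - cmap c z| < r / 2]; first exact: chart_nbhs.
  have cube y : `|y - cmap c z| <= r / 2 -> crange c y /\ round_at S c (cinv c y) A.
    by move=> yr; apply: h; lra.
  have zz : `|cmap c z - cmap c z| < r / 2 by rewrite subrr normr0.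
  by move=> y [cy ya]; split; apply: (controlled_transfer Ac r20 A0 cube).
have oP : open controlled.
  by rewrite openE => z cz; have [W nW hW] := nb z; apply: filterS nW => y /hW[h _]; exact: h.
have oN : open (~` controlled).
  by rewrite openE => z cz; have [W nW hW] := nb z; apply: filterS nW => y /hW[_ h] /h.
pose K := connected_component [set: M] x.
have : K `&` controlled = K.
  apply: component_connected; first by exists b0.
    by exists controlled.
  by exists controlled => //; rewrite -openC.
have Kx : K x by exact: connected_component_refl.
by move=> E; have [] : (K `&` controlled) x by rewrite E.
Qed.

End Propagation.

(** * The uniformity of a conformal manifold *)

Section Uniformity.
Variables (R : realType) (n : nat) (M : manifold R n) (S : conformal_structure M).
Hypothesis n1 : (1 < n)%N.

Let n0 : (0 < n)%N. Proof. exact: ltnW. Qed.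
Let i0 : 'I_n := Ordinal n0.

(** One point for each component: [base_eq] says that the choice depends on the
    component alone. *)
Definition base (x : M) : M := xget x (connected_component [set: M] x).

Lemma base_component x : connected_component [set: M] x (base x).
Proof. by apply: (xgetPex x); exists x; exact: connected_component_refl. Qed.

Lemma base_eq x y : connected_component [set: M] x y -> base x = base y.
Proof.
move=> xy; rewrite /base (same_connected_component xy).
have h : exists z, `[< connected_component [set: M] y z >].
  by exists y; apply/asboolP; exact: connected_component_refl.
by rewrite /xget; case: pselect.
Qed.

Definition good_chart (b : M) (c : chart R n M) (rho A : R) :=
  [/\ atlas c, cdom c b, 0 < rho, 0 < A & forall y, `|y - cmap c b| <= rho ->
      crange c y /\ round_at S c (cinv c y) A].

Lemma good_chart_ex b : exists cra : chart R n M * R * R, good_chart b cra.1.1 cra.1.2 cra.2.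
Proof.
have [c Ac cb] : exists2 c, atlas c & cdom c b.
  by have : [set: M] b by []; rewrite -(atlas_maximal M).1.1 => -[c]; exists c.
have [A [r [A0 r0 h]]] := round_near S Ac cb.
exists (c, r / 2, A); split => //=; first by rewrite divr_gt0.
by move=> y yr; apply: h; lra.
Qed.

Let cra b := projT1 (cid (good_chart_ex b)).
Let cb b := (cra b).1.1.
Let rb b := (cra b).1.2.
Let Ab b := (cra b).2.
Let craP b : good_chart b (cb b) (rb b) (Ab b).
Proof. exact: projT2 (cid (good_chart_ex b)). Qed.

(** The values taken by the first coordinate on the support of [u], inside the
    cube around the base point, have small measure. *)
Definition few_sheets b (u : M -> R) (e : R) := exists X : set R,
  [/\ measurable X, (lebesgue_measure X <= e%:E)%E &
   forall p, cdom (cb b) p -> `|cmap (cb b) p - cmap (cb b) b| < rb b -> u p != 0 ->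
     X (cmap (cb b) p 0 i0)].

Lemma few_sheets_mono b u e f : e <= f -> few_sheets b u e -> few_sheets b u f.
Proof.
by move=> ef [X [mX Xe hX]]; exists X; split => //; apply: le_trans Xe _; rewrite lee_fin.
Qed.

Lemma few_sheets_max b u v e f : few_sheets b u e -> few_sheets b v f ->
  few_sheets b (fun p => Num.max (u p) (v p)) (e + f).
Proof.
move=> [X [mX Xe hX]] [Y [mY Yf hY]]; exists (X `|` Y); split.
- exact: measurableU.
- have := @measureU2 _ _ _ (@lebesgue_measure R) X Y mX mY.
  rewrite EFinD => /le_trans; apply; exact: leeD.
- move=> p cp pr; rewrite /Num.max; case: ifP => _ h; [right; exact: hY|left; exact: hX].
Qed.

(** A function supported in a small set meets few sheets: if the support is far
    from the cube there are none, otherwise the width of the support bounds the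
    measure. *)
Lemma few_sheets_near b (x : M) e : 0 < e -> exists2 U, nbhs x U &
  forall u, (forall p, u p != 0 -> U p) -> few_sheets b u e.
Proof.
move=> e0; have [Ac cbb rho0 A0 cube] := craP b.
pose a := cmap (cb b) b.
pose K := [set p | cdom (cb b) p /\ `|cmap (cb b) p - a| <= rb b].
have Kc : closed K.
  by apply: chart_closed_cube; [exact: carrier_hausdorff|move=> y /cube[]].
have [Kx|nKx] := pselect (K x); last first.
  exists (~` K); first by apply: open_nbhs_nbhs; split => //; exact: closed_openC.
  move=> u hu; exists set0; split => //; first by rewrite measure0 lee_fin ltW.
  by move=> p cp pr /hu; case; split => //; exact: ltW.
have [cx _] := Kx; pose s := cmap (cb b) x 0 i0.
exists [set p | cdom (cb b) p /\ `|cmap (cb b) p - cmap (cb b) x| < e / 2].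
  by apply: chart_nbhs => //; rewrite divr_gt0.
move=> u hu; exists `](s - e / 2), (s + e / 2)[%classic; split => //.
  rewrite lebesgue_measure_itv/= lte_fin; case: ifP => _; last by rewrite lee_fin ltW.
  by rewrite -EFinB lee_fin; lra.
move=> p cp pr /hu[_ h]; rewrite /= in_itv/=.
have := le_lt_trans (row_coord_le _ i0) h; rewrite !mxE ltr_norml => /andP[h1 h2].
by apply/andP; split; rewrite /s; lra.
Qed.

Lemma few_sheets_avoid b u e : e < 2 * rb b -> few_sheets b u e ->
  exists2 s0, `|s0 - cmap (cb b) b 0 i0| < rb b &
    forall y, `|y - cmap (cb b) b| < rb b -> y 0 i0 = s0 -> u (cinv (cb b) y) = 0.
Proof.
move=> eb [X [mX Xe hX]]; have [Ac cbb rho0 A0 cube] := craP b.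
pose a := cmap (cb b) b 0 i0; set rho := rb b in eb rho0 cube hX *.
have [s0 [sI nX]] : exists s0, `](a - rho), (a + rho)[%classic s0 /\ ~ X s0.
  apply: contrapT => nex.
  have sub : `](a - rho), (a + rho)[%classic `<=` X.
    by move=> s sI; apply: contrapT => nX; apply: nex; exists s.
  pose I : set R := `](a - rho), (a + rho)[%classic.
  have mle : (lebesgue_measure I <= e%:E)%E.
    by apply: le_trans Xe; apply: le_measure => //; rewrite inE//; exact: measurable_itv.
  have lt : a - rho < a + rho by lra.
  by move: mle; rewrite /I lebesgue_measure_itv/= lte_fin lt -EFinB lee_fin; lra.
exists s0.
  move: sI; rewrite /= in_itv/= => /andP[h1 h2].
  by rewrite ltr_norml; apply/andP; split; rewrite -/a; lra.
move=> y ya yi; have [cy _] := cube y (ltW ya).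
apply: contrapT => /eqP uy; apply: nX; rewrite -yi -(cinvK cy).
by apply: hX => //; [exact: cinv_sub|rewrite cinvK].
Qed.

Definition adm b (e : R) u (delta : chart R n M -> M -> R) :=
  [/\ gauge delta, energy_le S u delta e & few_sheets b u e].

(** A sheet that avoids the support of [u] provides a slice on which [u] is
    zero. *)
Lemma base_controlled b : controlled (adm b) b.
Proof.
move=> U nU; have [Ac cbb rho0 A0 cube] := craP b.
have bb : `|cmap (cb b) b - cmap (cb b) b| < rb b by rewrite subrr normr0.
have [V nV hV] := control_near n1 Ac rho0 A0 cube cbb bb nU.
exists V => // eta eta0; have eta3 : 0 < eta / 3 by rewrite divr_gt0.
have [e1 e10 he1] := hV (eta / 3) eta3.
exists (Num.min e1 (rb b)); first by rewrite lt_min e10.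
move=> u delta [dg ue us] C conC CV CU.
have ue1 : energy_le S u delta e1 by apply: energy_le_mono ue; rewrite ge_min lexx.
have [|s0 s0b hs] := few_sheets_avoid _ us.
  have : Num.min e1 (rb b) <= rb b by rewrite ge_min lexx orbT.
  lra.
have [|p Cp up] := he1 u delta dg ue1 i0 s0 s0b _ C conC CV CU.
  by move=> y ya yi; rewrite hs// ltW.
by exists p => //; apply: (le_trans up); lra.
Qed.

(** The base point of the component of [x] is that of [y] too, since [C] is
    connected. *)
Definition conf_near (e : R) (x y : M) := exists (C : set M) u delta,
  [/\ connected C, C x, C y, forall p, C p -> 1 <= u p & adm (base x) e u delta].

Lemma conf_near_component e x y : conf_near e x y -> base x = base y.
Proof. by move=> [C [u [d [conC Cx Cy _ _]]]]; apply: base_eq; exists C. Qed.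

Lemma conf_near_sym e x y : conf_near e x y -> conf_near e y x.
Proof.
move=> h; have E := conf_near_component h; move: h => [C [u [d [conC Cx Cy Cu ad]]]].
by exists C, u, d; split => //; rewrite -E.
Qed.

Lemma conf_near_mono e f x y : e <= f -> conf_near e x y -> conf_near f x y.
Proof.
move=> ef [C [u [d [conC Cx Cy Cu [dg ue us]]]]]; exists C, u, d; split => //.
by split => //; [exact: energy_le_mono ue|exact: few_sheets_mono us].
Qed.

Lemma conf_near_trans e f x y z :
  conf_near e x y -> conf_near f y z -> conf_near (e + f) x z.
Proof.
move=> h; have E := conf_near_component h; move: h.
move=> [C [u [d [conC Cx Cy Cu [dg ue us]]]]] [D [v [d' [conD Dy Dz Dv [dg' ve vs]]]]].
exists (C `|` D), (fun p => Num.max (u p) (v p)), (fun c p => Num.min (d c p) (d' c p)).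
split; [|by left|by right| |].
- by apply: connectedU => //; exists y.
- by move=> p [/Cu|/Dv] h; rewrite le_max h ?orbT.
- split; first by move=> c p; rewrite lt_min dg dg'.
    exact: energy_le_max.
  by apply: (few_sheets_max us); rewrite E.
Qed.

Lemma conf_near_nbhs e x : 0 < e -> nbhs x (conf_near e x).
Proof.
move=> e0; have [U nU hU] := few_sheets_near (base x) x e0.
have [u [d [V [dg ue nV hV hu]]]] := small_capacity S n1 nU e0.
apply: filterS nV => y /hV[C [conC Cx Cy Cu]].
by exists C, u, d; split => //; split => //; exact: hU.
Qed.

(** Otherwise the continuum joining [x] to a point outside [U] would carry values
    of [u] below one half. *)
Lemma conf_near_small x U : nbhs x U -> exists2 e, 0 < e & conf_near e x `<=` U.
Proof.
move=> nU.
have ctrl : controlled (adm (base x)) x.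
  apply: (@controlled_component R n M S n1 (adm (base x)) _ _ x (base x)).
  - by move=> e u delta [].
  - move=> e f u delta ef [dg ue us]; split => //;
      [exact: energy_le_mono ue|exact: few_sheets_mono us].
  - exact: base_component.
  - exact: base_controlled.
have [V nV hV] := ctrl U nU.
have [e e0 he] := hV 2^-1 ltac:(by rewrite invr_gt0).
exists e => // y [C [u [d [conC Cx Cy Cu ad]]]]; apply: contrapT => nUy.
have [||p Cp up] := he u d ad C conC.
- by exists x; split => //; exact: nbhs_singleton.
- by move=> CU; apply: nUy; exact: CU.
by have := Cu p Cp; lra.
Qed.

Lemma conformal_paracompact : paracompact M.
Proof.
exact: (@uniform_paracompact R M conf_near conf_near_sym conf_near_mono conf_near_trans
  conf_near_nbhs conf_near_small).
Qed.

End Uniformity.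

Theorem theorem1 (R : realType) (n : nat) (hn : (2 <= n)%N)
  (M : conformal_manifold R n) : paracompact M.
Proof. exact: conformal_paracompact (structure M) hn. Qed.
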